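(* Let $X=V\big(\sum_{i=0}^5 x_i^3\big)\subset\mathbb{P}^5$ be the Fermat cubic fourfold over $\mathbb{C}$, let $F$ be its Fano scheme of lines and $F_2\subset F$ the locus of lines of second type. Then $F_2$ is the union of 10 copies of the self-product $C\times C$ of the Fermat cubic curve $C=V(x_0^3+x_1^3+x_2^3)\subset\mathbb{P}^2$ and 45 copies of the Fermat cubic surface $V(x_0^3+x_1^3+x_2^3+x_3^3)\subset\mathbb{P}^3$; that is, $F_2$ is the union of 55 distinct closed subvarieties, 10 of which are isomorphic to $C\times C$ and 45 of which are isomorphic to the Fermat cubic surface.
   Context: For a smooth cubic hypersurface $X\subset\mathbb{P}^{n+1}$ with $n\geq 3$, the Fano scheme of lines $F=F(X)\subset\mathrm{G}(2,n+2)$ parametrises the lines contained in $X$. A line $\ell\subset X$ is of second type if its normal bundle is $N_{\ell/X}\cong\mathcal{O}(-1)\oplus\mathcal{O}(1)^{\oplus(n-2)}$ (otherwise $N_{\ell/X}\cong\mathcal{O}^{\oplus 2}\oplus\mathcal{O}(1)^{\oplus(n-3)}$ and $\ell$ is of first type); equivalently there is a linear $\mathbb{P}^{n-1}\subset\mathbb{P}^{n+1}$ containing $\ell$ and tangent to $X$ at every point of $\ell$. $F_2=F_2(X)\subset F$ is the locus of lines of second type; it is reduced of pure dimension $n-2$. *)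

(* Defs.v *)
(* Projective varieties are handled through their closed points: over an
   algebraically closed field a reduced closed subscheme of P^m is a closed
   subset of the set of 1-dimensional subspaces of K^(m+1). *)
From mathcomp Require Import all_boot all_order all_algebra.
From mathcomp Require Import classical_sets reals.
From mathcomp Require Import complex mpoly.

Set Implicit Arguments.
Unset Strict Implicit.
Unset Printing Implicit Defensive.

Import GRing.Theory.
Local Open Scope ring_scope.
Local Open Scope classical_set_scope.

Section ProjectiveVarieties.
Variable K : closedFieldType.

(* The points of P(K^N) = P^(N-1) are the p : {vspace 'rV[K]_N} with
   \dim p = 1; other subspaces are not points. *)
Definition zero_locus N (fs : seq {mpoly K[N]}) : set {vspace 'rV[K]_N} :=
  [set p | \dim p = 1%N /\
     forall (f : {mpoly K[N]}) (v : 'rV[K]_N),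
       f \in fs -> v \in p -> f.@[v 0] = 0].

Definition zariski_closed N (Z : set {vspace 'rV[K]_N}) : Prop :=
  exists fs : seq {mpoly K[N]},
    (forall f, f \in fs -> exists d : nat, f \is d.-homog) /\
    Z = zero_locus fs.

Definition eval_tuple N M (g : 'I_M -> {mpoly K[N]}) (v : 'rV[K]_N)
    : 'rV[K]_M :=
  \row_j (g j).@[v 0].

(* phi is only meaningful on Z: around every point p of Z, on a basic open
   neighbourhood {h != 0}, it is given by forms g_j of a common degree without
   common zero there. *)
Definition regular_on N M (Z : set {vspace 'rV[K]_N})
    (phi : {vspace 'rV[K]_N} -> {vspace 'rV[K]_M}) : Prop :=
  forall p, Z p ->
  exists (e d : nat) (h : {mpoly K[N]}) (g : 'I_M -> {mpoly K[N]}),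
    [/\ h \is e.-homog,
        forall j, g j \is d.-homog,
        exists2 v, v \in p & h.@[v 0] != 0
      & forall v, Z <[v]>%VS -> h.@[v 0] != 0 ->
          eval_tuple g v != 0 /\ phi <[v]>%VS = <[eval_tuple g v]>%VS].

Definition variety_isom N M (Z : set {vspace 'rV[K]_N})
    (Z' : set {vspace 'rV[K]_M}) : Prop :=
  exists (phi : {vspace 'rV[K]_N} -> {vspace 'rV[K]_M})
         (psi : {vspace 'rV[K]_M} -> {vspace 'rV[K]_N}),
    [/\ regular_on Z phi /\ regular_on Z' psi,
        forall p, Z p -> Z' (phi p),
        forall q, Z' q -> Z (psi q),
        forall p, Z p -> psi (phi p) = p
      & forall q, Z' q -> phi (psi q) = q].

(* Product of projective varieties, as a subvariety of P(K^N (x) K^M) through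
   the Segre embedding ([u], [v]) |-> [u_i v_j]. *)
Definition segre_product N M (Z : set {vspace 'rV[K]_N})
    (Z' : set {vspace 'rV[K]_M}) : set {vspace 'rV[K]_(N * M)} :=
  [set q | exists u v, [/\ Z <[u]>%VS, Z' <[v]>%VS
                         & q = <[mxvec (u^T *m v)]>%VS]].

Definition hypersurface N (f : {mpoly K[N]}) : set {vspace 'rV[K]_N} :=
  zero_locus [:: f].

(* Lines of P^(N-1) are the 2-dimensional subspaces of K^N. *)
Definition fano_lines N (f : {mpoly K[N]}) : set {vspace 'rV[K]_N} :=
  [set l | \dim l = 2%N /\
     forall p, \dim p = 1%N -> (p <= l)%VS -> hypersurface f p].

(* Affine tangent space at the nonzero vector v to the cone f = 0. *)
Definition tangent_at N (f : {mpoly K[N]}) (v w : 'rV[K]_N) : Prop :=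
  \sum_(i < N) (f^`M(i)).@[v 0] * w 0 i = 0.

Definition int_homog N (d : int) (f : {mpoly K[N]}) : Prop :=
  match d with
  | Posz k => f \is k.-homog
  | Negz _ => f = 0
  end.

(* N_{l/X} is isomorphic to the direct sum of the O(a_i), for a line l in
   X = V(f) along which X is smooth.
   By the Euler sequence N_{l/P} = (K^N / l) (x) O_l(1), and N_{l/X} is its
   subbundle with fibre (T_v / l) (x) O_l(1) at [v], T_v the affine tangent
   space.  A morphism O_l(a) -> N_{l/P} is a form of degree 1 - a on l with
   values in K^N / l; such a form lifts to K^N and, componentwise, extends from
   l to a form u on K^N.  A sum of such morphisms is an isomorphism onto
   N_{l/X} iff for every point [v] of l the values at v form a basis of T_v
   modulo l, i.e. together with a basis of l they form a basis of T_v. *)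
Definition normal_bundle_isom N (f : {mpoly K[N]}) (l : {vspace 'rV[K]_N})
    (a : seq int) : Prop :=
  exists u : 'I_(size a) -> 'I_N -> {mpoly K[N]},
    (forall (i : 'I_(size a)) (j : 'I_N), int_homog (1 - a`_i) (u i j)) /\
    forall v, v \in l -> v != 0 ->
      let b := vbasis l ++ [seq eval_tuple (u i) v | i <- enum 'I_(size a)] in
      free b /\ forall w, w \in <<b>>%VS <-> tangent_at f v w.

(* N_{l/X} = O(-1) + O(1)^(n-2) for X = V(f) in P^(n+1). *)
Definition second_type_lines n (f : {mpoly K[n.+2]})
    : set {vspace 'rV[K]_n.+2} :=
  [set l | fano_lines f l /\
     normal_bundle_isom f l ((-1) :: nseq (n - 2) 1)].

(* Pluecker embedding: the line spanned by u and v is sent to [u /\ v], where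
   /\^2 K^N is realised as the alternating matrices, u /\ v = u^T v - v^T u.
   Up to a nonzero factor this does not depend on the basis (u, v). *)
Definition plucker N (l : {vspace 'rV[K]_N}) : {vspace 'rV[K]_(N * N)} :=
  let u := (vbasis l)`_0 in
  let v := (vbasis l)`_1 in
  <[mxvec (u^T *m v - v^T *m u)]>%VS.

(* F_2(X), as a subset of the Pluecker-embedded Grassmannian. *)
Definition F2_locus n (f : {mpoly K[n.+2]})
    : set {vspace 'rV[K]_(n.+2 * n.+2)} :=
  @plucker n.+2 @` second_type_lines f.

Definition fermat_cubic N : {mpoly K[N]} := \sum_(i < N) 'X_i ^+ 3.

End ProjectiveVarieties.

(* Main.v *)
Require Import Defs.
From mathcomp Require Import all_boot all_order all_algebra.
From mathcomp Require Import classical_sets reals.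
From mathcomp Require Import complex mpoly ring zify.

Set Implicit Arguments.
Unset Strict Implicit.
Unset Printing Implicit Defensive.

Import GRing.Theory.
Local Open Scope ring_scope.
Local Open Scope classical_set_scope.

(** A line [<p, q>] of the Fermat cubic is of second type iff the tangent
    hyperplanes at its points contain a common space of codimension 2.  The
    tangent hyperplane at [v] has coefficients [v_x^2], so along the line these
    coefficient vectors span the space of [p_x^2], [p_x q_x], [q_x^2].  Since
    three distinct points of a conic are independent, that span has dimension 2
    iff the points [(p_x : q_x)] of the projective line, over the indices [x]
    where they are defined, take exactly two values, i.e. iff the line has a
    basis of two vectors with disjoint supports ([three_columns],
    [second_type_split]).  Conversely such a basis yields explicit generators
    of the normal bundle ([split_second_type]).  So the lines of second type
    are exactly those joining two points of the cubic with disjoint supports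
    ([second_type_linesP], [F2_fermatP]).

    In six variables, a point of the cubic has at least two nonzero
    coordinates.  Either both points have three, and the line is one of those
    joining two plane Fermat cubics in complementary coordinate planes, for one
    of 10 partitions; or one point has two, is then one of three points
    [(1 : c)] with [c^3 = -1] on one of 15 coordinate lines, and the other point
    runs over the Fermat surface in the complementary four coordinates
    ([F2_pieces]).

    For complementary coordinate subspaces, [u (x) v |-> u /\ v] is an
    injective linear map with a linear left inverse ([cross_homK]).  Each
    component is therefore the image of a Segre product, or of a surface, under
    a linear embedding of projective spaces, hence closed and isomorphic to it
    ([closed_linear_image], [isom_linear_image], [segre_product_closed]).
    Distinct components are told apart by the zero pattern of a point with full
    support and by the ratio [c] ([piece_inj]). *)

(** * Closed sets and linear embeddings of projective spaces *)

Section Projective.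
Variable K : closedFieldType.
Implicit Types N M : nat.

Lemma var_exp_homog N (i : 'I_N) d : ('X_i ^+ d : {mpoly K[N]}) \is d.-homog.
Proof.
have /(dhomogMn d) : ('X_i : {mpoly K[N]}) \is 1.-homog
  by rewrite dhomogX /= mdeg1.
by rewrite mul1n.
Qed.

Definition linear_form N (c : 'I_N -> K) : {mpoly K[N]} := \sum_i c i *: 'X_i.

Lemma linear_form_homog N (c : 'I_N -> K) : linear_form c \is 1.-homog.
Proof.
by apply: rpred_sum => i _; apply/rpredZ; apply: (var_exp_homog i 1).
Qed.

Lemma linear_formE N (c v : 'I_N -> K) :
  (linear_form c).@[v] = \sum_i c i * v i.
Proof.
by rewrite raddf_sum; apply: eq_bigr => i _; rewrite /= mevalZ mevalXU.
Qed.

Definition lin_comp N M (f : 'Hom('rV[K]_N, 'rV[K]_M)) (F : {mpoly K[M]}) :=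
  F \mPo [tuple linear_form ((lin1_mx f)^~ j) | j < M].

Lemma eval_linear_form N M (f : 'Hom('rV[K]_N, 'rV[K]_M)) j (v : 'rV[K]_N) :
  (linear_form ((lin1_mx f)^~ j)).@[v 0] = f v 0 j.
Proof.
rewrite linear_formE -[f v]mul_rV_lin1 mxE.
by apply: eq_bigr => i _; rewrite mulrC.
Qed.

Lemma lin_compE N M (f : 'Hom('rV[K]_N, 'rV[K]_M)) F (v : 'rV[K]_N) :
  (lin_comp f F).@[v 0] = F.@[f v 0].
Proof.
rewrite comp_mpoly_meval; apply: meval_eq => j.
by rewrite tnth_mktuple eval_linear_form.
Qed.

Lemma lin_comp_homog N M (f : 'Hom('rV[K]_N, 'rV[K]_M)) F d :
  F \is d.-homog -> lin_comp f F \is d.-homog.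
Proof.
move=> /dhomogP hF; rewrite /lin_comp comp_mpolyEX.
rewrite big_seq; apply: rpred_sum => m /hF dm.
rewrite comp_mpolyX; apply/rpredZ; rewrite -dm /= mdegE.
elim/big_rec2: _ => [|i e P _ hP]; first exact: dhomog1.
rewrite tnth_mktuple; apply: dhomogM hP.
by have := dhomogMn (m i) (linear_form_homog ((lin1_mx f)^~ i)); rewrite mul1n.
Qed.

Lemma homog_meval_scale N (F : {mpoly K[N]}) d (c : K) (v : 'rV[K]_N) :
  F \is d.-homog -> F.@[(c *: v) 0] = c ^+ d * F.@[v 0].
Proof.
move=> /dhomogP hF; rewrite !mevalE big_distrr /= !big_seq.
apply: eq_bigr => m /hF dm; rewrite mulrCA; congr (_ * _).
rewrite -dm /= mdegE -prodrXr -big_split /=; apply: eq_bigr => i _.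
by rewrite mxE exprMn.
Qed.

Lemma dim1_line N (p : {vspace 'rV[K]_N}) :
  \dim p = 1%N -> exists2 v, v != 0 & p = <[v]>%VS.
Proof.
move=> dp; have vn0 : vpick p != 0.
  by rewrite vpick0; apply: contraPneq dp => ->; rewrite dimv0.
exists (vpick p) => //; apply/esym/eqP.
by rewrite eqEdim -memvE memv_pick dp dim_vline vn0.
Qed.

Lemma line_scale N (c : K) (v : 'rV[K]_N) :
  c != 0 -> <[c *: v]>%VS = <[v]>%VS.
Proof.
move=> c0; apply/eqP; rewrite eqEsubv -!memvE memvZ ?memv_line //=.
by apply/vlineP; exists c^-1; rewrite scalerA mulVf // scale1r.
Qed.

Lemma line_eq N (v w : 'rV[K]_N) :
  v != 0 -> <[v]>%VS = <[w]>%VS -> exists2 c, c != 0 & v = c *: w.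
Proof.
move=> v0 e; have /vlineP[c vE] : v \in <[w]>%VS by rewrite -e memv_line.
by exists c => //; apply: contra_neq v0 => c0; rewrite vE c0 scale0r.
Qed.

Definition forms N (Fs : seq {mpoly K[N]}) :=
  forall F, F \in Fs -> exists d, F \is d.-homog.

(** A form vanishes on a whole line as soon as it vanishes at one nonzero
    vector of it, so membership can be tested on any representative. *)
Lemma zero_locus_line N (Fs : seq {mpoly K[N]}) v : forms Fs ->
  zero_locus Fs <[v]>%VS <-> v != 0 /\ forall F, F \in Fs -> F.@[v 0] = 0.
Proof.
move=> hF; rewrite /zero_locus /= dim_vline; split.
  by move=> [v0 h]; split=> [|F /h]; [case: eqP v0|apply; rewrite memv_line].
move=> [-> h]; split=> // F w FF /vlineP[c ->].
by have [d hd] := hF F FF; rewrite (homog_meval_scale _ _ hd) h ?mulr0.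
Qed.

Lemma closed_point N (Z : set {vspace 'rV[K]_N}) p :
  zariski_closed Z -> Z p -> exists2 v, v != 0 & p = <[v]>%VS.
Proof. by move=> [Fs [_ ->]] [/dim1_line]. Qed.

Lemma closed_point_neq0 N (Z : set {vspace 'rV[K]_N}) v :
  zariski_closed Z -> Z <[v]>%VS -> v != 0.
Proof. by move=> [Fs [_ ->]] [+ _]; rewrite dim_vline; case: eqP. Qed.

Lemma regular_on_linear N M (Z : set {vspace 'rV[K]_N})
    (f : 'Hom('rV[K]_N, 'rV[K]_M)) :
  (forall v, Z <[v]>%VS -> f v != 0) -> regular_on Z (fun p => f @: p)%VS.
Proof.
move=> fn0 p Zp; exists 0%N, 1%N, 1, (fun j => linear_form ((lin1_mx f)^~ j)).
split=> [|j||v Zv _]; first exact: dhomog1.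
- exact: linear_form_homog.
- by exists 0; rewrite ?mem0v // meval1 oner_eq0.
have -> : eval_tuple (fun j => linear_form ((lin1_mx f)^~ j)) v = f v.
  by apply/rowP => j; rewrite mxE eval_linear_form.
by rewrite limg_line fn0.
Qed.

(** An injective linear map identifies a closed set with its image: the inverse
    is again given by linear forms.  The left inverse [g] is what supplies the
    equations of the image, namely those of [Z] pulled back along [g], together
    with the linear equations [w = f (g w)] of the subspace [limg f]. *)
Section LinearImage.
Variables (N M : nat) (f : 'Hom('rV[K]_N, 'rV[K]_M)).
Variables (g : 'Hom('rV[K]_M, 'rV[K]_N)) (Z : set {vspace 'rV[K]_N}).
Hypotheses (fK : cancel f g) (Zcl : zariski_closed Z).

Lemma closed_linear_image :
  zariski_closed [set f @: p | p in Z]%VS.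
Proof.
have [Fs [homF ZE]] := Zcl.
pose h : 'Hom('rV[K]_M, 'rV[K]_M) := (\1 - (f \o g))%VF.
pose Gs := [seq lin_comp g F | F <- Fs] ++
           [seq linear_form ((lin1_mx h)^~ j) | j <- enum 'I_M].
have homG : forms Gs.
  move=> G; rewrite mem_cat => /orP[/mapP[F /homF[d hd] ->]|/mapP[j _ ->]].
    by exists d; apply: lin_comp_homog.
  by exists 1%N; apply: linear_form_homog.
exists Gs; split=> //; apply/seteqP; split=> q /=.
  move=> [p Zp <-]; have [v v0 pE] := closed_point Zcl Zp.
  rewrite pE limg_line; apply/zero_locus_line => //; split.
    by apply: contra_neq v0 => fv0; rewrite -[v]fK fv0 linear0.
  move=> G; rewrite mem_cat => /orP[/mapP[F FF ->]|/mapP[j _ ->]].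
    rewrite lin_compE fK; move: Zp; rewrite ZE pE.
    by move=> /(zero_locus_line _ homF)[_]; apply.
  rewrite eval_linear_form /h.
  by rewrite add_lfunE opp_lfunE comp_lfunE id_lfunE fK subrr mxE.
move=> Gq; have [w w0 qE] : exists2 w, w != 0 & q = <[w]>%VS.
  by apply: dim1_line; case: Gq.
move: Gq; rewrite qE => /(zero_locus_line _ homG)[_ Gw].
have fgw : f (g w) = w.
  apply/rowP => j; apply/esym/eqP; rewrite -subr_eq0; apply/eqP.
  have := Gw (linear_form ((lin1_mx h)^~ j)).
  rewrite eval_linear_form /h.
  rewrite add_lfunE opp_lfunE comp_lfunE id_lfunE !mxE; apply.
  by rewrite mem_cat map_f ?orbT ?mem_enum.
exists <[g w]>%VS; last by rewrite limg_line fgw.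
rewrite ZE; apply/zero_locus_line => //; split.
  by apply: contra_neq w0 => gw0; rewrite -fgw gw0 linear0.
by move=> F FF; rewrite -lin_compE Gw // mem_cat map_f.
Qed.

Lemma isom_linear_image : variety_isom [set f @: p | p in Z]%VS Z.
Proof.
have gfK p : (g @: (f @: p))%VS = p.
  rewrite -limg_comp (_ : (g \o f)%VF = \1%VF) ?lim1g //.
  by apply/lfunP => v; rewrite comp_lfunE id_lfunE fK.
have imZ q : [set f @: p | p in Z]%VS q -> Z (g @: q)%VS.
  by move=> [p Zp <-]; rewrite gfK.
exists (fun q => g @: q)%VS, (fun p => f @: p)%VS; split=> //.
- split; apply: regular_on_linear => v.
    by move=> /imZ; rewrite limg_line; apply: closed_point_neq0.
  move=> /(closed_point_neq0 Zcl); apply: contra_neq => fv0.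
  by rewrite -[v]fK fv0 linear0.
- by move=> p Zp; exists p.
- by move=> q [p Zp <-]; rewrite gfK.
Qed.

End LinearImage.

Lemma hypersurface_closed N (F : {mpoly K[N]}) d :
  F \is d.-homog -> zariski_closed (hypersurface F).
Proof.
move=> hF; exists [:: F]; split=> // G; rewrite inE => /eqP->.
by exists d.
Qed.

End Projective.

(** * The Segre product of closed sets *)

Section Segre.
Variable K : closedFieldType.
Implicit Types N M : nat.

Definition col_hom N M (j : 'I_M) : 'Hom('rV[K]_(N * M), 'rV[K]_N) :=
  linfun (trmx \o col j \o vec_mx).

Definition row_hom N M (i : 'I_N) : 'Hom('rV[K]_(N * M), 'rV[K]_M) :=
  linfun (row i \o vec_mx).

Definition minor N M (t : 'I_N * 'I_N * ('I_M * 'I_M)) : {mpoly K[N * M]} :=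
  let: (i, i', (j, j')) := t in
  'X_(mxvec_index i j) * 'X_(mxvec_index i' j') -
  'X_(mxvec_index i j') * 'X_(mxvec_index i' j).

Lemma minor_homog N M (t : 'I_N * 'I_N * ('I_M * 'I_M)) :
  minor t \is 2.-homog.
Proof.
case: t => [[i i'] [j j']]; apply: rpredB;
  exact: (dhomogM (var_exp_homog K _ 1) (var_exp_homog K _ 1)).
Qed.

Lemma row_neq0 N (v : 'rV[K]_N) : v != 0 -> exists i, v 0 i != 0.
Proof. by case/matrix0Pn => i [j]; rewrite ord1 => ?; exists j. Qed.

Lemma outer_neq0 N M (u : 'rV[K]_N) (v : 'rV[K]_M) :
  u != 0 -> v != 0 -> u^T *m v != 0.
Proof.
move=> /row_neq0[i ui] /row_neq0[j vj]; apply/matrix0Pn; exists i, j.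
by rewrite mxE big_ord1 mxE mulf_neq0.
Qed.

(** The equations are the 2x2 minors, which say that the matrix is [u^T *m v],
    and the equations of the factors imposed on every column and every row,
    which are multiples of [u] and [v]. *)
Lemma segre_product_closed N M (Z : set {vspace 'rV[K]_N})
    (Z' : set {vspace 'rV[K]_M}) :
  zariski_closed Z -> zariski_closed Z' -> zariski_closed (segre_product Z Z').
Proof.
move=> Zcl Z'cl; have [Fs [homF ZE]] := Zcl; have [Fs' [homF' Z'E]] := Z'cl.
pose Gs := [seq minor t | t <- enum {: 'I_N * 'I_N * ('I_M * 'I_M)}] ++
  [seq lin_comp (col_hom N j) F | F <- Fs, j <- enum 'I_M] ++
  [seq lin_comp (row_hom M i) F | F <- Fs', i <- enum 'I_N].
have homG : forms Gs.
  move=> G; rewrite !mem_cat => /or3P[/mapP[t _ ->]|/allpairsP[t [/homF+ _ ->]]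
    |/allpairsP[t [/homF'+ _ ->]]].
  - by exists 2%N; apply: minor_homog.
  - by move=> [d hd]; exists d; apply: lin_comp_homog.
  - by move=> [d hd]; exists d; apply: lin_comp_homog.
exists Gs; split=> //; apply/seteqP; split=> q /=.
  move=> [u [v [Zu Zv ->]]]; apply/zero_locus_line => //.
  have u0 := closed_point_neq0 Zcl Zu; have v0 := closed_point_neq0 Z'cl Zv.
  move: Zu Zv; rewrite ZE Z'E => /(zero_locus_line _ homF)[_ Fu].
  move=> /(zero_locus_line _ homF')[_ Fv].
  split; first by rewrite mxvec_eq0 outer_neq0.
  move=> G; rewrite !mem_cat => /or3P[/mapP[t _ ->]|/allpairsP[t [FF _ ->]]
    |/allpairsP[t [FF _ ->]]].
  - case: t => [[i i'] [j j']]; rewrite mevalB !mevalM !mevalXU !mxvecE.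
    by rewrite !mxE !big_ord1 !mxE; ring.
  - have [d hd] := homF _ FF; rewrite lin_compE lfunE /= mxvecK.
    have -> : (col t.2 (u^T *m v))^T = v 0 t.2 *: u.
      by apply/rowP => k; rewrite !mxE big_ord1 !mxE mulrC.
    by rewrite (homog_meval_scale _ _ hd) Fu ?mulr0.
  - have [d hd] := homF' _ FF; rewrite lin_compE lfunE /= mxvecK.
    have -> : row t.2 (u^T *m v) = u 0 t.2 *: v.
      by apply/rowP => k; rewrite !mxE big_ord1 !mxE.
    by rewrite (homog_meval_scale _ _ hd) Fv ?mulr0.
move=> Gq; have [w w0 qE] : exists2 w, w != 0 & q = <[w]>%VS.
  by apply: dim1_line; case: Gq.
move: Gq; rewrite qE => /(zero_locus_line _ homG)[_ Gw].
have [W wE] : exists W : 'M_(N, M), w = mxvec W.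
  by exists (vec_mx w); rewrite vec_mxK.
move: w0 Gw; rewrite {}wE mxvec_eq0 => /matrix0Pn[i0 [j0 W0]] Gw {qE}.
(* A nonzero entry (i0, j0) exhibits the matrix as column j0 times row i0. *)
have minW i j : W i j0 * W i0 j = W i j * W i0 j0.
  have := Gw (minor (i, i0, (j0, j))).
  rewrite mevalB !mevalM !mevalXU !mxvecE => /(_ _)/eqP.
  rewrite subr_eq0 => h; apply/eqP/h.
  by rewrite mem_cat map_f ?mem_enum.
exists (col j0 W)^T, ((W i0 j0)^-1 *: row i0 W); split.
- rewrite ZE; apply/zero_locus_line => //; split.
    by apply: contra_neq W0 => /rowP/(_ i0); rewrite !mxE.
  move=> F FF; have := Gw (lin_comp (col_hom N j0) F).
  rewrite lin_compE lfunE /= mxvecK; apply.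
  rewrite !mem_cat; apply/or3P; constructor 2.
  by apply/allpairsP; exists (F, j0); rewrite mem_enum.
- rewrite line_scale ?invr_eq0 // Z'E; apply/zero_locus_line => //; split.
    by apply: contra_neq W0 => /rowP/(_ j0); rewrite !mxE.
  move=> F FF; have := Gw (lin_comp (row_hom M i0) F).
  rewrite lin_compE lfunE /= mxvecK; apply.
  rewrite !mem_cat; apply/or3P; constructor 3.
  by apply/allpairsP; exists (F, i0); rewrite mem_enum.
- congr <[mxvec _]>%VS; apply/matrixP => i j.
  by rewrite mxE big_ord1 !mxE mulrCA minW mulrC mulfK.
Qed.

End Segre.

(** * The Fermat cubic form and its polarization *)

Section FermatLines.
Variable K : closedFieldType.

(** The symmetric trilinear form whose cubic form is the Fermat cubic; the
    tangent space at [v] is the kernel of [polar v v]. *)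
Definition polar N (u v w : 'rV[K]_N) : K := \sum_i u 0 i * v 0 i * w 0 i.

Lemma polarC N (u v w : 'rV[K]_N) : polar u v w = polar v u w.
Proof. by apply: eq_bigr => i _; rewrite [u 0 i * _]mulrC. Qed.

Lemma polarCr N (u v w : 'rV[K]_N) : polar u v w = polar u w v.
Proof. by apply: eq_bigr => i _; rewrite mulrAC. Qed.

Lemma polar_linear N (u v w w' : 'rV[K]_N) c :
  polar u v (c *: w + w') = c * polar u v w + polar u v w'.
Proof.
rewrite /polar big_distrr -big_split; apply: eq_bigr => i _ /=.
by rewrite !mxE; ring.
Qed.

Lemma polar0 N (u v : 'rV[K]_N) : polar u v 0 = 0.
Proof. by apply: big1 => i _; rewrite mxE mulr0. Qed.

Lemma polarZ N (u v w : 'rV[K]_N) c : polar u v (c *: w) = c * polar u v w.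
Proof. by rewrite -[c *: w]addr0 polar_linear polar0 addr0. Qed.

Lemma polarD N (u v w w' : 'rV[K]_N) :
  polar u v (w + w') = polar u v w + polar u v w'.
Proof. by rewrite -[w]scale1r polar_linear !scale1r mul1r. Qed.

Lemma polar_delta N (u v : 'rV[K]_N) i :
  polar u v (delta_mx 0 i) = u 0 i * v 0 i.
Proof.
rewrite /polar (bigD1 i) //= big1 ?addr0 => [|j ji]; rewrite mxE eqxx /=.
  by rewrite eqxx mulr1.
by rewrite (negPf ji) mulr0.
Qed.

Lemma fermat_homog N : fermat_cubic K N \is 3.-homog.
Proof. by apply: rpred_sum => i _; apply: var_exp_homog. Qed.

Lemma fermat_eval N (v : 'rV[K]_N) : (fermat_cubic K N).@[v 0] = polar v v v.
Proof.
rewrite raddf_sum; apply: eq_bigr => i _ /=.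
by rewrite rmorphXn /= mevalXU !exprS expr0 mulr1 mulrA.
Qed.

Lemma fermat_hypersurface N (v : 'rV[K]_N) :
  hypersurface (fermat_cubic K N) <[v]>%VS <-> v != 0 /\ polar v v v = 0.
Proof.
rewrite -fermat_eval; split.
  move=> [d h]; split; last by apply: h; rewrite ?memv_line // inE.
  by move: d; rewrite dim_vline; case: eqP.
move=> [v0 Fv]; apply/zero_locus_line; last first.
  by split=> // F; rewrite inE => /eqP->.
by move=> F; rewrite inE => /eqP->; exists 3%N; apply: fermat_homog.
Qed.

Lemma fermat_tangent N (v w : 'rV[K]_N) : 3%:R != 0 :> K ->
  tangent_at (fermat_cubic K N) v w <-> polar v v w = 0.
Proof.
move=> n3; rewrite /tangent_at.
suff -> : \sum_(i < N) ((fermat_cubic K N)^`M(i)).@[v 0] * w 0 i =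
          3%:R * polar v v w.
  by split=> [/eqP|->]; rewrite ?mulr0 // mulf_eq0 (negPf n3) => /eqP.
rewrite /polar big_distrr; apply: eq_bigr => i _ /=.
rewrite mulrA; congr (_ * _).
have dX j : ('X_j : {mpoly K[N]})^`M(i) = (i == j)%:R%:MP.
  rewrite mderivX mnm1E eq_sym; case: eqP => [->|_]; last first.
    by rewrite scale0r mpolyC0.
  rewrite scale1r (_ : U_(j) - U_(j) = 0)%MM ?mpolyX0 //.
  by apply/mnmP => k; rewrite mnmBE subnn mnm0E.
rewrite /fermat_cubic (linear_sum (mderiv i)) /= raddf_sum /=.
rewrite (bigD1 i) //= big1 => [|j ji]; rewrite !exprS expr0 !mderivM dX mderivC.
  rewrite eqxx !(mevalD, mevalM, mevalC, mevalXU).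
  by rewrite addr0 -[true%:R]/(1 : K); ring.
rewrite eq_sym (negPf ji).
by rewrite !(mevalD, mevalM, mevalC, mul0r, mulr0, addr0).
Qed.

End FermatLines.

(** * Lines of second type on Fermat cubics *)

Section SecondType.
Variable K : closedFieldType.
Implicit Types N n : nat.

Definition det2 N (p q : 'rV[K]_N) (i j : 'I_N) : K :=
  p 0 i * q 0 j - p 0 j * q 0 i.

Lemma memv_span2 N (p q v : 'rV[K]_N) :
  reflect (exists s t, v = s *: p + t *: q) (v \in <<[:: p; q]>>%VS).
Proof.
rewrite span_cons span_seq1; apply: (iffP memv_addP).
  by move=> [_ /vlineP[s ->] [_ /vlineP[t ->] ->]]; exists s, t.
move=> [s [t ->]]; exists (s *: p); first by rewrite memvZ ?memv_line.
by exists (t *: q) => //; rewrite memvZ ?memv_line.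
Qed.

Lemma dim2_span N (l : {vspace 'rV[K]_N}) :
  \dim l = 2%N -> exists p q, free [:: p; q] /\ l = <<[:: p; q]>>%VS.
Proof.
move=> dl; have := vbasisP l; case: (vbasis l); rewrite dl.
move=> [|p [|q []]] //= _ lb; exists p, q.
by rewrite (basis_free lb) (span_basis lb).
Qed.

Lemma free2_det N (p q : 'rV[K]_N) :
  free [:: p; q] -> exists i j, det2 p q i j != 0.
Proof.
rewrite free_cons span_seq1 seq1_free => /andP[pq q0].
have [j qj] := row_neq0 q0.
pose r := p - (p 0 j / q 0 j) *: q.
have /row_neq0[i ri] : r != 0.
  apply: contraNneq pq => /eqP; rewrite subr_eq0 => /eqP->.
  by rewrite memvZ ?memv_line.
exists i, j; apply: contra_neq ri => d0; rewrite !mxE.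
apply: (mulIf qj); rewrite mul0r -[RHS]d0 mulrBl; congr (_ - _).
by rewrite mulrAC divfK.
Qed.

Lemma disjoint_free N (p q : 'rV[K]_N) :
  p != 0 -> q != 0 -> (forall i, p 0 i * q 0 i = 0) -> free [:: p; q].
Proof.
move=> p0 q0 pq; rewrite free_cons span_seq1 seq1_free q0 andbT.
apply/vlineP => -[c pE]; have [i pi] := row_neq0 p0.
have /eqP := pq i; rewrite mulf_eq0 (negPf pi) /= => /eqP qi.
by move: pi; rewrite pE mxE qi mulr0 eqxx.
Qed.

Lemma dim_rV N : \dim {:'rV[K]_N} = N.
Proof. by rewrite dimvf dim_matrix mul1r. Qed.

(** The three quadrics [p p], [p q], [q q] in the coordinates of [p] and [q] are
    the values at the points [(p_x : q_x)] of the projective line of a basis of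
    binary quadratic forms.  If three of these points, indexed by [s], are
    distinct, the forms [L a] vanishing at the two points other than the [a]-th
    restrict to independent functionals on the coordinates [s 0], [s 1], [s 2];
    hence a space [W] killed by all quadrics meets that coordinate subspace
    trivially. *)
Lemma three_columns N (W : {vspace 'rV[K]_N}) (p q : 'rV[K]_N)
    (s : 'I_3 -> 'I_N) :
    (forall w, w \in W ->
      [/\ polar p p w = 0, polar p q w = 0 & polar q q w = 0]) ->
    (forall a b : 'I_3, (a < b)%N -> det2 p q (s a) (s b) != 0) ->
  (\dim W + 3 <= N)%N.
Proof.
move=> Wpq ds_lt.
have ds a b : a != b -> det2 p q (s a) (s b) != 0.
  rewrite neq_ltn => /orP[/ds_lt//|/ds_lt].
  by rewrite /det2 -oppr_eq0 opprB ![p 0 (s a) * _]mulrC ![p 0 (s b) * _]mulrC.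
pose L a x := det2 p q x (s (a + 1)) * det2 p q x (s (a + 2%:R)).
have L0 a b : b != a -> L a (s b) = 0.
  move=> ba; have : (b == a + 1) || (b == a + 2%:R).
    by case: a b ba => [[|[|[|//]]] ?] [[|[|[|//]]] ?].
  by case/orP => /eqP->; rewrite /L /det2 subrr ?(mulr0, mul0r).
have Ln0 a : L a (s a) != 0.
  by rewrite mulf_neq0 ?ds // eq_sym -subr_eq0 addrC addKr.
have LW a w : w \in W -> \sum_x L a x * w 0 x = 0.
  move=> /Wpq[pp pq qq]; set b := s (a + 1); set c := s (a + 2%:R).
  transitivity (q 0 b * q 0 c * polar p p w
    - (p 0 b * q 0 c + p 0 c * q 0 b) * polar p q w
    + p 0 b * p 0 c * polar q q w); last by rewrite pp pq qq !mulr0 subrr addr0.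
  rewrite /polar !big_distrr -sumrB -big_split; apply: eq_bigr => x _.
  by rewrite /L /det2 -/b -/c /=; ring.
(* The inclusion of the coordinate subspace spanned by the s a. *)
pose g : 'Hom('rV[K]_3, 'rV[K]_N) :=
  linfun (mulmxr (\matrix_(a, x) (x == s a)%:R)).
have gE y a : \sum_x L a x * g y 0 x = y 0 a * L a (s a).
  transitivity (\sum_x \sum_b L a x * (y 0 b * (x == s b)%:R)).
    apply: eq_bigr => x _; rewrite lfunE /= mxE big_distrr.
    by apply: eq_bigr => b _; rewrite mxE.
  rewrite exchange_big (bigD1 a) //= [X in _ + X]big1 ?addr0 => [|b ba].
    rewrite (bigD1 (s a)) //= eqxx mulr1 big1 ?addr0 1?mulrC // => x xa.
    by rewrite (negPf xa) !mulr0.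
  apply: big1 => x _; case: eqP => [->|]; last by rewrite !mulr0.
  by rewrite L0 ?mul0r.
have gW y : g y \in W -> y = 0.
  move=> gyW; apply/rowP => a; apply: (mulIf (Ln0 a)).
  by rewrite -gE LW // mxE mul0r.
have dg : \dim (limg g) = 3%N.
  rewrite limg_dim_eq; first exact: dim_rV.
  rewrite capfv; apply/eqP; rewrite -subv0; apply/subvP => y.
  by rewrite memv_ker memv0 => /eqP gy; rewrite (gW y) // gy mem0v.
rewrite -[X in (_ + X)%N]dg -dimv_disjoint_sum.
  by rewrite -[X in (_ <= X)%N](dim_rV N) dimvS ?subvf.
apply/eqP; rewrite -subv0; apply/subvP => w /memv_capP[wW].
case/memv_imgP => y _ wE; move: wW; rewrite wE => /gW->.
by rewrite linear0 mem0v.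
Qed.

Lemma homog0_const N (F : {mpoly K[N]}) (v : 'rV[K]_N) :
  F \is 0.-homog -> F.@[v 0] = F.@[(0 : 'rV[K]_N) 0].
Proof.
by move=> hF; rewrite -(scale0r v) (homog_meval_scale _ _ hF) mul1r.
Qed.

(** The summands [O(1)] are given by forms of degree 0, that is by constant
    vectors; with the line they span a fixed linear space lying in the tangent
    space at every point of the line. *)
Lemma second_type_tangent_space n (l : {vspace 'rV[K]_n.+2}) :
    3%:R != 0 :> K -> (2 <= n)%N ->
    second_type_lines (fermat_cubic K n.+2) l ->
  exists2 W : {vspace 'rV[K]_n.+2}, \dim W = n &
    forall v w, v \in l -> w \in W -> polar v v w = 0.
Proof.
move=> n3 n2 [[dl _] [u [homu hu]]].
pose m := size (nseq (n - 2) 1%:Z).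
pose W0 := [seq eval_tuple (u (lift ord0 i)) 0 | i : 'I_m <- enum 'I_m].
have sW0 : size W0 = (n - 2)%N by rewrite size_map size_enum_ord /m size_nseq.
have u0 (i : 'I_m) v :
    eval_tuple (u (lift ord0 i)) v = eval_tuple (u (lift ord0 i)) 0.
  apply/rowP => x; rewrite !mxE; apply: homog0_const.
  have := homu (lift ord0 i) x; rewrite /= nth_nseq.
  have -> // : (i < n - 2)%N.
  by rewrite -[X in (_ < X)%N](size_nseq (n - 2) 1%:Z) ltn_ord.
pose X := vbasis l ++ W0.
have bE v : vbasis l ++ [seq eval_tuple (u i) v |
      i <- enum 'I_(size (-1 :: nseq (n - 2) 1%:Z))]
    = vbasis l ++ eval_tuple (u ord0) v :: W0.
  congr (_ ++ _); rewrite enum_ordSl /= -map_comp; congr (_ :: _).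
  by apply: eq_map => i /=; apply: u0.
have lT v w : v \in l -> w \in <<X>>%VS -> polar v v w = 0.
  move=> vl wX; have [->|v0] := eqVneq v 0.
    by apply: big1 => i _; rewrite mxE !mul0r.
  have [_ /(_ w)[h _]] := hu v vl v0; apply/fermat_tangent => //; apply: h.
  rewrite bE; move: w wX; apply/subvP/sub_span => w.
  by rewrite !mem_cat in_cons => /orP[->|->] //; rewrite !orbT.
exists <<X>>%VS => //.
have [v vl v0] : exists2 v, v \in l & v != 0.
  by exists (vpick l); rewrite ?memv_pick // vpick0 -dimv_eq0 dl.
have [] := hu v vl v0; rewrite bE => + _.
rewrite -cat1s (perm_free (permEl (perm_catCA _ _ _))) => /catr_free.
move=> /eqP ->; rewrite size_cat sW0 size_tuple dl.
by rewrite addnC subnK.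
Qed.

(** Bases of this kind characterize the lines of second type among all lines,
    see [second_type_linesP]. *)
Definition split_pair N (p q : 'rV[K]_N) : Prop :=
  [/\ p != 0, q != 0, forall i, p 0 i * q 0 i = 0,
      polar p p p = 0 & polar q q q = 0].

(** The tangent spaces along the line contain a common space of codimension 2,
    so at most two of the points [(p_x : q_x)] are distinct, say those of
    indices [i] and [j].  Eliminating the coordinates [j] and [i] between [p]
    and [q] gives a basis [p'], [q'] of the line, and a coordinate of index [k]
    of [p'] or of [q'] vanishes according to which of the two it gives. *)
Lemma second_type_split n (l : {vspace 'rV[K]_n.+2}) :
    2%:R != 0 :> K -> 3%:R != 0 :> K -> (2 <= n)%N ->
    second_type_lines (fermat_cubic K n.+2) l ->
  exists p q, split_pair p q /\ l = <<[:: p; q]>>%VS.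
Proof.
move=> c2 c3 n2 hl; have [W dW WT] := second_type_tangent_space c3 n2 hl.
have [[dl lX] _] := hl; have [p [q [fpq lE]]] := dim2_span dl.
have pl : p \in l by rewrite lE memv_span ?inE ?eqxx.
have ql : q \in l by rewrite lE memv_span ?inE ?eqxx ?orbT.
have Wpq w : w \in W ->
    [/\ polar p p w = 0, polar p q w = 0 & polar q q w = 0].
  move=> wW; have pp := WT _ _ pl wW; have qq := WT _ _ ql wW.
  split=> //; have := WT _ _ (memvD pl ql) wW.
  rewrite polarCr polarD polarCr polarC polarCr polarD.
  rewrite [X in _ + X]polarCr [X in _ + X]polarC [X in _ + X]polarCr polarD.
  rewrite ![polar _ w _]polarCr pp qq [polar q p w]polarC add0r addr0 -mulr2n.
  by rewrite -mulr_natl => /eqP; rewrite mulf_eq0 (negPf c2) => /eqP.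
have [i [j dij]] := free2_det fpq.
have det0 k : det2 p q k j * det2 p q k i = 0.
  apply/eqP/negPn/negP; rewrite mulf_eq0 negb_or => /andP[dkj dki].
  have dC x y : det2 p q x y = - det2 p q y x by rewrite /det2; ring.
  suff : (n + 3 <= n.+2)%N by rewrite addn3 ltnn.
  rewrite -[X in (X + 3)%N]dW.
  apply: (three_columns (s := tnth [tuple i; j; k]) Wpq).
  case=> [[|[|[|//]]] ?] [[|[|[|//]]] ?] //= _; rewrite !(tnth_nth i) //=.
  - by rewrite dC oppr_eq0.
  - by rewrite dC oppr_eq0.
pose p' := q 0 j *: p - p 0 j *: q; pose q' := q 0 i *: p - p 0 i *: q.
have p'E k : p' 0 k = det2 p q k j by rewrite !mxE /det2; ring.
have q'E k : q' 0 k = det2 p q k i by rewrite !mxE /det2; ring.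
have p'0 : p' != 0.
  by apply: contra_neq dij => p'0; rewrite -p'E p'0 mxE.
have q'0 : q' != 0.
  apply: contra_neq dij => q'0; have := q'E j; rewrite q'0 mxE /det2 => /eqP.
  rewrite eq_sym subr_eq0 => /eqP e.
  by rewrite /det2; apply/eqP; rewrite subr_eq0 e.
have cubic v : v != 0 -> v \in l -> polar v v v = 0.
  move=> v0 vl.
  have /fermat_hypersurface[//] : hypersurface (fermat_cubic K n.+2) <[v]>%VS.
  by apply: lX; rewrite ?dim_vline ?v0 // -memvE.
have p'l : p' \in l by rewrite memvB ?memvZ.
have q'l : q' \in l by rewrite memvB ?memvZ.
have pq'0 k : p' 0 k * q' 0 k = 0 by rewrite p'E q'E.
exists p', q'; split; first by split=> //; apply: cubic.
apply/esym/eqP; rewrite eqEdim; apply/andP; split.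
  by apply/span_subvP => v; rewrite !inE => /orP[]/eqP->.
by have /eqP-> := disjoint_free p'0 q'0 pq'0; rewrite dl.
Qed.

(** Mixed terms vanish for disjoint supports. *)
Lemma polar_split N (p q w : 'rV[K]_N) s t : (forall i, p 0 i * q 0 i = 0) ->
  polar (s *: p + t *: q) (s *: p + t *: q) w =
    s ^+ 2 * polar p p w + t ^+ 2 * polar q q w.
Proof.
move=> pq; rewrite /polar !big_distrr -big_split; apply: eq_bigr => i _ /=.
rewrite !mxE -[LHS](subr0 _) -(mulr0 (2%:R * s * t * w 0 i)) -(pq i).
ring.
Qed.

Lemma split_fano N (p q : 'rV[K]_N) :
  split_pair p q -> fano_lines (fermat_cubic K N) <<[:: p; q]>>%VS.
Proof.
move=> [p0 q0 pq pp qq]; split; first exact/eqP/disjoint_free.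
move=> x /dim1_line[v v0 ->]; rewrite -memvE => /memv_span2[s [t vE]].
apply/fermat_hypersurface; split=> //; rewrite [in LHS]vE polar_split //.
rewrite !polarD !polarZ pp qq !mulr0 add0r addr0.
have z1 : polar p p q = 0 by apply: big1 => i _; rewrite -mulrA pq mulr0.
have z2 : polar q q p = 0.
  by apply: big1 => i _; rewrite -mulrA [q 0 i * p 0 i]mulrC pq mulr0.
by rewrite z1 z2 !mulr0 addr0.
Qed.

(** The linear space tangent along the whole line: it is cut out by the two
    functionals [polar p p] and [polar q q], independent because [p] and [q] are
    nonzero with disjoint supports. *)
Lemma polar_ker_dim N (p q : 'rV[K]_N) :
    p != 0 -> q != 0 -> (forall i, p 0 i * q 0 i = 0) ->
  exists2 W : {vspace 'rV[K]_N}, (\dim W + 2 = N)%N &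
    forall w, w \in W <-> polar p p w = 0 /\ polar q q w = 0.
Proof.
move=> /row_neq0[i pi] /row_neq0[j qj] pq.
have qi : q 0 i = 0 by have /eqP := pq i; rewrite mulf_eq0 (negPf pi) => /eqP.
have pj : p 0 j = 0.
  by have /eqP := pq j; rewrite mulf_eq0 (negPf qj) orbF => /eqP.
pose G : 'M[K]_(N, 1 + 1) := row_mx (\col_x p 0 x ^+ 2) (\col_x q 0 x ^+ 2).
pose h : 'Hom('rV[K]_N, 'rV[K]_(1 + 1)) := linfun (mulmxr G).
have hE w : h w = row_mx (polar p p w)%:M (polar q q w)%:M.
  rewrite lfunE /= mul_mx_row; congr row_mx; apply/rowP => a;
    rewrite !mxE ord1 mulr1n; apply: eq_bigr => x _; rewrite mxE mulrC expr2 //.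
have limh : limg h = fullv.
  apply/vspaceP => y; rewrite memvf; apply/memv_imgP.
  pose a := lsubmx y 0 0 / p 0 i ^+ 2; pose b := rsubmx y 0 0 / q 0 j ^+ 2.
  exists (a *: delta_mx 0 i + b *: delta_mx 0 j); first exact: memvf.
  rewrite hE !polar_linear !polarZ !polar_delta pj qi !(mul0r, mulr0).
  rewrite add0r addr0.
  rewrite -!expr2 /a /b !divfK ?expf_neq0 // -[LHS]hsubmxK.
  by congr row_mx; rewrite [LHS]mx11_scalar.
exists (lker h) => [|w].
  have := limg_ker_dim h fullv; rewrite capfv limh !dim_rV.
  by [].
rewrite memv_ker hE -[0 in X in X <-> _]row_mx0; split.
  by move=> /eqP/eq_row_mx[/matrixP/(_ 0 0) + /matrixP/(_ 0 0)]; rewrite !mxE.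
by move=> [-> ->]; rewrite !raddf0 row_mx0.
Qed.

(** With [p_i != 0] and [q_j != 0], the tangent space at [v] is the kernel of
    [s^2 polar p p + t^2 polar q q], where [v = s p + t q].  It contains the
    fixed space [W] of codimension 2, a complement of the line in which gives
    the summands [O(1)]; the quadratic vector [v_j^2 e_i - v_i^2 e_j] is tangent
    at [v] and outside [W], and gives the summand [O(-1)]. *)
Lemma split_second_type n (p q : 'rV[K]_n.+2) :
    3%:R != 0 :> K -> (2 <= n)%N -> split_pair p q ->
  second_type_lines (fermat_cubic K n.+2) <<[:: p; q]>>%VS.
Proof.
move=> c3 n2 spq; have lF := split_fano spq; split=> //.
have [p0 q0 pq pp qq] := spq; have [dl _] := lF.
set l := <<[:: p; q]>>%VS in lF dl *.
have [W dW WE] := polar_ker_dim p0 q0 pq.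
have lW : (l <= W)%VS.
  apply/span_subvP => v; rewrite !inE => /orP[]/eqP->; apply/WE; split=> //.
    by apply: big1 => i _; rewrite -mulrA [q 0 i * p 0 i]mulrC pq mulr0.
  by apply: big1 => i _; rewrite -mulrA pq mulr0.
have dC : \dim (W :\: l) = (n - 2)%N.
  have := dimv_cap_compl W l; rewrite (capv_idPr lW) dl => d.
  by apply/eqP; rewrite -(eqn_add2l 2) d subnKC // -(eqn_add2r 2) dW addn2.
have sC : size (vbasis (W :\: l)) = (n - 2)%N by rewrite size_tuple.
have [[i pi] [j qj]] := (row_neq0 p0, row_neq0 q0).
have qi : q 0 i = 0 by have /eqP := pq i; rewrite mulf_eq0 (negPf pi) => /eqP.
have pj : p 0 j = 0.
  by have /eqP := pq j; rewrite mulf_eq0 (negPf qj) orbF => /eqP.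
pose u k (x : 'I_n.+2) : {mpoly K[n.+2]} :=
  if k is k'.+1 then ((vbasis (W :\: l))`_k' 0 x)%:MP
  else (delta_mx 0 i : 'rV_n.+2) 0 x *: 'X_j ^+ 2 -
       (delta_mx 0 j : 'rV_n.+2) 0 x *: 'X_i ^+ 2.
pose u0 (v : 'rV[K]_n.+2) : 'rV[K]_n.+2 :=
  (v 0 j) ^+ 2 *: delta_mx 0 i + (- (v 0 i) ^+ 2) *: delta_mx 0 j.
have u0E v : eval_tuple (u 0%N) v = u0 v.
  apply/rowP => x; rewrite !mxE mevalB !mevalZ !rmorphXn /= !mevalXU !mxE.
  by rewrite mulNr eqxx ![_%:R * _]mulrC.
pose a := -1 :: nseq (n - 2) 1%:Z.
exists (fun k : 'I_(size a) => u k); split.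
  case=> [[|k] /= hk] x.
    by rewrite rpredB // rpredZ // var_exp_homog.
  move: hk; rewrite ltnS size_nseq nth_nseq => -> /=.
  by rewrite -[_%:MP]mulr1 mul_mpolyC rpredZ // dhomog1.
move=> v vl v0; rewrite -/a.
have -> : [seq eval_tuple (u k) v | k : 'I_(size a) <- enum 'I_(size a)] =
          u0 v :: vbasis (W :\: l).
  rewrite (map_comp (fun k => eval_tuple (u k) v) (@nat_of_ord _)) val_enum_ord.
  rewrite /a /= u0E size_nseq; congr (_ :: _).
  rewrite (iotaDl 1 0) -map_comp -[RHS](mkseq_nth 0) sC.
  by apply: eq_map => k /=; apply/rowP => x; rewrite mxE mevalC.
set C := (W :\: l)%VS.
have cW : (l + C = W)%VS by rewrite addvC addv_diff; apply/addv_idPl.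
have X_basis : basis_of W (vbasis l ++ vbasis C).
  rewrite -cW; apply: cat_basis; rewrite ?vbasisP //.
  by apply/directv_addP; rewrite capvC capv_diff.
have perm_b : perm_eq (vbasis l ++ u0 v :: vbasis C)
    (u0 v :: vbasis l ++ vbasis C).
  by rewrite -cat1s -[X in perm_eq _ X]cat1s perm_catCA.
have ppu : polar p p (u0 v) = p 0 i ^+ 2 * v 0 j ^+ 2.
  by rewrite polar_linear polarZ !polar_delta pj; ring.
have qqu : polar q q (u0 v) = - (q 0 j ^+ 2 * v 0 i ^+ 2).
  by rewrite polar_linear polarZ !polar_delta qi; ring.
have /memv_span2[s [t vE]] := vl.
have vi : v 0 i = s * p 0 i by rewrite vE !mxE qi mulr0 addr0.
have vj : v 0 j = t * q 0 j by rewrite vE !mxE pj mulr0 add0r.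
have TE w : polar v v w = s ^+ 2 * polar p p w + t ^+ 2 * polar q q w.
  by rewrite vE polar_split.
have uT : polar v v (u0 v) = 0 by rewrite TE ppu qqu vi vj; ring.
pose m := p 0 i ^+ 2 * q 0 j ^+ 2.
have m0 : m != 0 by rewrite mulf_neq0 ?expf_neq0.
have st0 : (s != 0) || (t != 0).
  rewrite -negb_and; apply: contra_neqN v0 => /andP[/eqP s0 /eqP t0].
  by rewrite vE s0 t0 !scale0r addr0.
have uW : u0 v \notin W.
  apply/negP => /WE[]; rewrite ppu qqu vi vj => /eqP + /eqP.
  rewrite oppr_eq0 !mulf_eq0 (negPf pi) (negPf qj) /= !orbF !orbb.
  by move=> t0 s0; move: st0; rewrite t0 s0.
split.
  rewrite (perm_free perm_b) free_cons (span_basis X_basis) uW.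
  exact: basis_free X_basis.
move=> w; rewrite fermat_tangent // (eq_span (perm_mem perm_b)).
rewrite span_cons (span_basis X_basis); split.
  move=> /memv_addP[_ /vlineP[c ->] [w' /WE[ppw qqw] ->]].
  by rewrite polar_linear uT TE ppw qqw !mulr0 !addr0.
rewrite TE => wT.
(* w - c u0(v) lies in W for the solution c of these two equations. *)
suff [c [cp cq]] : exists c, polar p p w = c * (m * t ^+ 2) /\
                             polar q q w = - c * (m * s ^+ 2).
  rewrite -[w](subrK (c *: u0 v)) addrC memv_add ?memvZ ?memv_line //.
  apply/WE; rewrite addrC -scaleNr (polar_linear p p) (polar_linear q q).
  rewrite cp cq ppu qqu vi vj /m.
  by split; ring.
have [t0|t0] := eqVneq t 0.
  move: wT st0; rewrite t0 eqxx orbF expr0n /= mul0r addr0 => /eqP wT s0.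
  exists (- polar q q w / (m * s ^+ 2)).
  rewrite !mulr0 !mulNr opprK divfK ?mulf_neq0 ?expf_neq0 //.
  by move: wT; rewrite mulf_eq0 expf_eq0 /= (negPf s0) => /eqP.
exists (polar p p w / (m * t ^+ 2)).
have mt : m * t ^+ 2 != 0 by rewrite mulf_neq0 ?expf_neq0.
rewrite divfK //; split=> //; apply: (mulIf mt).
rewrite !mulNr [X in - X]mulrAC divfK //.
move/eqP: wT; rewrite addr_eq0 => /eqP wT.
transitivity (- m * (- (t ^+ 2 * polar q q w))); first by ring.
by rewrite -wT; ring.
Qed.

Theorem second_type_linesP n (l : {vspace 'rV[K]_n.+2}) :
    2%:R != 0 :> K -> 3%:R != 0 :> K -> (2 <= n)%N ->
  second_type_lines (fermat_cubic K n.+2) l <->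
  exists p q, split_pair p q /\ l = <<[:: p; q]>>%VS.
Proof.
move=> c2 c3 n2; split; first exact: second_type_split.
by move=> [p [q [spq ->]]]; apply: split_second_type.
Qed.

(** * The Pluecker image of the locus of second type *)

Definition wedge N (p q : 'rV[K]_N) : 'M[K]_N := p^T *m q - q^T *m p.

Definition wedge_line N (p q : 'rV[K]_N) : {vspace 'rV[K]_(N * N)} :=
  <[mxvec (wedge p q)]>%VS.

Lemma wedgeE N (p q : 'rV[K]_N) i j : wedge p q i j = det2 p q i j.
Proof. by rewrite !mxE !big_ord1 !mxE /det2 [q 0 i * _]mulrC. Qed.

Lemma wedge_comb N (p q : 'rV[K]_N) a b c d :
  wedge (a *: p + b *: q) (c *: p + d *: q) = (a * d - b * c) *: wedge p q.
Proof. by apply/matrixP => i j; rewrite [RHS]mxE !wedgeE /det2 !mxE; ring. Qed.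

Lemma wedge_lineC N (p q : 'rV[K]_N) : wedge_line p q = wedge_line q p.
Proof.
rewrite /wedge_line -(@line_scale _ _ (-1) (mxvec (wedge q p))).
  congr <[_]>%VS; rewrite -linearZ; congr mxvec; apply/matrixP => i j.
  by rewrite [RHS]mxE !wedgeE /det2; ring.
by rewrite oppr_eq0 oner_eq0.
Qed.

Lemma wedge_lineZ N (p q : 'rV[K]_N) c :
  c != 0 -> wedge_line (c *: p) q = wedge_line p q.
Proof.
move=> c0; rewrite /wedge_line -(line_scale (mxvec (wedge p q)) c0) -linearZ.
congr <[mxvec _]>%VS; apply/matrixP => i j.
by rewrite [RHS]mxE !wedgeE /det2 !mxE; ring.
Qed.

Lemma wedge_neq0 N (p q : 'rV[K]_N) : free [:: p; q] -> wedge p q != 0.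
Proof.
move=> /free2_det[i [j dij]]; apply: contra_neq dij => w0.
by rewrite -wedgeE w0 mxE.
Qed.

(** A change of basis multiplies [wedge] by its determinant, which is nonzero
    because [wedge] of either basis is. *)
Lemma plucker_span N (p q : 'rV[K]_N) :
  free [:: p; q] -> plucker <<[:: p; q]>>%VS = wedge_line p q.
Proof.
move=> fpq; rewrite /plucker /wedge_line; set l := <<_>>%VS.
have := vbasisP l; case: (vbasis l); rewrite (_ : \dim l = 2%N); last exact/eqP.
move=> [|u [|v []]] //= _ lb; rewrite -[_ - _]/(wedge u v).
have inl x : x \in [:: u; v] -> exists s t, x = s *: p + t *: q.
  by move=> /(basis_mem lb) /memv_span2.
have [a [b uE]] : exists s t, u = s *: p + t *: q.
  by apply: inl; rewrite inE eqxx.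
have [c [d vE]] : exists s t, v = s *: p + t *: q.
  by apply: inl; rewrite !inE eqxx orbT.
have := wedge_neq0 (basis_free lb); rewrite uE vE wedge_comb => w0.
rewrite linearZ line_scale //; apply: contra_neq w0 => ->.
by rewrite scale0r.
Qed.

Lemma F2_fermatP n (x : {vspace 'rV[K]_(n.+2 * n.+2)}) :
    2%:R != 0 :> K -> 3%:R != 0 :> K -> (2 <= n)%N ->
  F2_locus (fermat_cubic K n.+2) x <->
  exists p q, split_pair p q /\ x = wedge_line p q.
Proof.
move=> c2 c3 n2; split.
  move=> [l /(second_type_linesP _ c2 c3 n2)[p [q [spq ->]]] <-].
  exists p, q; split=> //; have [p0 q0 pq _ _] := spq.
  exact/plucker_span/disjoint_free.
move=> [p [q [spq ->]]]; exists <<[:: p; q]>>%VS.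
  by apply/second_type_linesP => //; exists p, q.
by have [p0 q0 pq _ _] := spq; apply/plucker_span/disjoint_free.
Qed.

End SecondType.

(** * Coordinate subspaces *)

Section Coordinates.
Variable K : closedFieldType.
Implicit Types N k m : nat.

(** Right multiplication by it places the coordinates of a vector at the
    indices [f i] and fills up with zeros. *)
Definition embed_mx N k (f : 'I_k -> 'I_N) : 'M[K]_(k, N) :=
  \matrix_(i, x) (x == f i)%:R.

Lemma embed_in N k (f : 'I_k -> 'I_N) (u : 'rV[K]_k) i :
  injective f -> (u *m embed_mx f) 0 (f i) = u 0 i.
Proof.
move=> finj; rewrite mxE (bigD1 i) //= big1 => [|j ji]; rewrite !mxE.
  by rewrite eqxx mulr1 addr0.
by rewrite (inj_eq finj) eq_sym (negPf ji) mulr0.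
Qed.

Lemma embed_out N k (f : 'I_k -> 'I_N) (u : 'rV[K]_k) x :
  (forall i, x != f i) -> (u *m embed_mx f) 0 x = 0.
Proof.
by move=> fx; rewrite mxE big1 // => i _; rewrite mxE (negPf (fx i)) mulr0.
Qed.

Lemma embed_eq0 N k (f : 'I_k -> 'I_N) (u : 'rV[K]_k) :
  injective f -> (u *m embed_mx f == 0) = (u == 0).
Proof.
move=> finj; apply/eqP/eqP => [e|->]; last by rewrite mul0mx.
by apply/rowP => i; rewrite -(embed_in u i finj) e !mxE.
Qed.

Lemma embedP N k (f : 'I_k -> 'I_N) (p : 'rV[K]_N) : injective f ->
    (forall x, p 0 x != 0 -> exists i, x = f i) ->
  p = (\row_i p 0 (f i)) *m embed_mx f.
Proof.
move=> finj pf; apply/rowP => x; have [px|/pf[i ->]] := eqVneq (p 0 x) 0.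
  have [/existsP[i /eqP->]|/existsPn nfx] := boolP [exists i, x == f i].
    by rewrite embed_in // mxE.
  by rewrite px embed_out.
by rewrite embed_in // mxE.
Qed.

Lemma polar_embed N k (f : 'I_k -> 'I_N) (u : 'rV[K]_k) :
  injective f ->
  polar (u *m embed_mx f) (u *m embed_mx f) (u *m embed_mx f) = polar u u u.
Proof.
move=> finj; set p := u *m embed_mx f.
transitivity (\sum_x \sum_i p 0 x * p 0 x * (u 0 i * (x == f i)%:R)).
  apply: eq_bigr => x _; rewrite [X in _ * X = _]mxE big_distrr.
  by apply: eq_bigr => i _; rewrite !mxE.
rewrite exchange_big; apply: eq_bigr => i _ /=.
rewrite (bigD1 (f i)) //= big1 => [|x xf]; last by rewrite (negPf xf) !mulr0.
by rewrite eqxx mulr1 addr0 embed_in.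
Qed.

(** For disjoint coordinate subspaces the map [u (x) v |-> u /\ v] is
    injective: the bilinear form is read off the off-diagonal block of the
    alternating matrix. *)
Section Cross.
Variables (N k m : nat) (f : 'I_k -> 'I_N) (g : 'I_m -> 'I_N).

Definition block_hom : 'Hom('rV[K]_(k * m), 'rV[K]_(N * N)) :=
  linfun (mxvec \o mulmx (embed_mx f)^T \o mulmxr (embed_mx g) \o vec_mx).

Definition cross_hom : 'Hom('rV[K]_(k * m), 'rV[K]_(N * N)) :=
  (block_hom - (linfun (mxvec \o trmx \o vec_mx) \o block_hom))%VF.

Definition cross_inv : 'Hom('rV[K]_(N * N), 'rV[K]_(k * m)) :=
  linfun (mxvec \o mulmx (embed_mx f) \o mulmxr (embed_mx g)^T \o vec_mx).

Lemma cross_homE M : cross_hom (mxvec M) =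
  mxvec ((embed_mx f)^T *m M *m embed_mx g -
         ((embed_mx f)^T *m M *m embed_mx g)^T).
Proof.
rewrite add_lfunE opp_lfunE comp_lfunE [block_hom _]lfunE /= mxvecK mulmxA.
by rewrite lfunE /= mxvecK linearB.
Qed.

Lemma cross_hom_outer u v : cross_hom (mxvec (u^T *m v)) =
  mxvec (wedge (u *m embed_mx f) (v *m embed_mx g)).
Proof.
rewrite cross_homE /wedge; congr mxvec.
by rewrite !trmx_mul !trmxK !mulmxA.
Qed.

Hypotheses (finj : injective f) (ginj : injective g).
Hypothesis fg : forall i j, f i != g j.

Lemma cross_homK : cancel cross_hom cross_inv.
Proof.
have orth k' m' (f' : 'I_k' -> 'I_N) (g' : 'I_m' -> 'I_N) i j :
    (embed_mx f' *m (embed_mx g')^T) i j = (f' i == g' j)%:R.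
  rewrite mxE (bigD1 (f' i)) //= big1 => [|x xf]; rewrite !mxE.
    by rewrite eqxx mul1r addr0.
  by rewrite (negPf xf) mul0r.
have ff : embed_mx f *m (embed_mx f)^T = 1%:M.
  by apply/matrixP => i j; rewrite orth mxE (inj_eq finj).
have gg : embed_mx g *m (embed_mx g)^T = 1%:M.
  by apply/matrixP => i j; rewrite orth mxE (inj_eq ginj).
have f0g : embed_mx f *m (embed_mx g)^T = 0.
  by apply/matrixP => i j; rewrite orth mxE (negPf (fg i j)).
move=> w; rewrite -[w]vec_mxK; set M := vec_mx w.
rewrite cross_homE lfunE /= mxvecK; congr mxvec.
rewrite mulmxBl mulmxBr !trmx_mul trmxK !mulmxA ff f0g mul1mx.
by rewrite -mulmxA gg mulmx1 !mul0mx subr0.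
Qed.

End Cross.

End Coordinates.

(** * The two kinds of components *)

Section Pieces.
Variable K : closedFieldType.

(** The [i]-th element of [A], to be used with [#|A| = k]; the default value
    [ord0] is then never reached. *)
Definition elt n (A : {set 'I_n.+1}) k (i : 'I_k) : 'I_n.+1 :=
  nth ord0 (enum A) i.

Lemma elt_in n (A : {set 'I_n.+1}) k (i : 'I_k) : #|A| = k -> elt A i \in A.
Proof. by move=> hA; rewrite -mem_enum mem_nth // -cardE hA. Qed.

Lemma elt_inj n (A : {set 'I_n.+1}) k : #|A| = k -> injective (@elt n A k).
Proof.
move=> hA i j /eqP; rewrite nth_uniq ?enum_uniq -?cardE ?hA //.
by move=> /eqP/val_inj.
Qed.

Lemma eltP n (A : {set 'I_n.+1}) k x : #|A| = k -> x \in A ->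
  exists i : 'I_k, x = elt A i.
Proof.
move=> hA xA; have lt : (index x (enum A) < k)%N.
  by rewrite -hA cardE index_mem mem_enum.
by exists (Ordinal lt); rewrite /elt nth_index ?mem_enum.
Qed.

Definition split_along N (A : {set 'I_N}) (p q : 'rV[K]_N) : Prop :=
  split_pair p q /\ forall x, if x \in A then q 0 x = 0 else p 0 x = 0.

Definition cubic N : set {vspace 'rV[K]_N} := hypersurface (fermat_cubic K N).

Arguments cubic N : clear implicits.

Lemma cubic_closed N : zariski_closed (cubic N).
Proof. exact: hypersurface_closed (fermat_homog K N). Qed.

Section Along.
Variables (n k m : nat) (A : {set 'I_n.+1}).
Hypotheses (hA : #|A| = k) (hA' : #|~: A| = m).

Let f : 'I_k -> 'I_n.+1 := @elt n A k.
Let g : 'I_m -> 'I_n.+1 := @elt n (~: A) m.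

Lemma elt_disjoint i j : f i != g j.
Proof.
rewrite /f /g; apply: contraTneq (elt_in i hA) => ->.
by have := elt_in j hA'; rewrite inE.
Qed.

Lemma split_along_embed (u : 'rV[K]_k) (v : 'rV[K]_m) :
    cubic k <[u]>%VS -> cubic m <[v]>%VS ->
  split_along A (u *m embed_mx K f) (v *m embed_mx K g).
Proof.
move=> /fermat_hypersurface[u0 uu] /fermat_hypersurface[v0 vv].
have [fi gi] : injective f /\ injective g by split; apply: elt_inj.
have supp x : if x \in A then (v *m embed_mx K g) 0 x = 0
              else (u *m embed_mx K f) 0 x = 0.
  case: ifP => xA; apply: embed_out => i.
    by apply: contraTneq xA => ->; have := elt_in i hA'; rewrite inE.
  by apply: contraFneq xA => ->; rewrite elt_in.
split=> //; split; rewrite ?embed_eq0 ?polar_embed // => x.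
by have := supp x; case: ifP => _ ->; rewrite ?mulr0 ?mul0r.
Qed.

Lemma split_alongP (p q : 'rV[K]_n.+1) : split_along A p q ->
  let u := \row_i p 0 (f i) in let v := \row_i q 0 (g i) in
  [/\ p = u *m embed_mx K f, q = v *m embed_mx K g,
      cubic k <[u]>%VS & cubic m <[v]>%VS].
Proof.
move=> [[p0 q0 pq pp qq] supp] u v.
have [fi gi] : injective f /\ injective g by split; apply: elt_inj.
have pE : p = u *m embed_mx K f.
  apply: embedP => // x px; apply: eltP => //; apply: contraNT px => xA.
  by have := supp x; rewrite (negPf xA) => ->.
have qE : q = v *m embed_mx K g.
  apply: embedP => // x qx; apply: eltP => //; rewrite inE.
  by apply: contra_neqN qx => xA; have := supp x; rewrite xA.
split=> //; apply/fermat_hypersurface.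
  by rewrite -(embed_eq0 u fi) -(polar_embed u fi) -pE.
by rewrite -(embed_eq0 v gi) -(polar_embed v gi) -qE.
Qed.

Definition cross : 'Hom('rV[K]_(k * m), 'rV[K]_(n.+1 * n.+1)) :=
  cross_hom K f g.

Lemma crossK : cancel cross (cross_inv K f g).
Proof.
by apply: cross_homK; [exact: elt_inj|exact: elt_inj|exact: elt_disjoint].
Qed.

(** On the Segre product, [cross] sends a pair of points of the cubics in the two
    complementary coordinate subspaces to the line joining them. *)
Definition product_piece :=
  [set cross @: l | l in segre_product (cubic k) (cubic m)]%VS.

Lemma product_pieceP l : product_piece l <->
  exists p q, split_along A p q /\ l = wedge_line p q.
Proof.
split.
  move=> [_ [u [v [cu cv ->]]] <-].
  exists (u *m embed_mx K f), (v *m embed_mx K g).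
  by split; [exact: split_along_embed|rewrite limg_line cross_hom_outer].
move=> [p [q [/split_alongP[pE qE cu cv] ->]]].
set u := \row_i p 0 (f i) in pE cu; set v := \row_i q 0 (g i) in qE cv.
exists <[mxvec (u^T *m v)]>%VS; first by exists u, v.
by rewrite limg_line cross_hom_outer -pE -qE.
Qed.

Lemma product_piece_closed : zariski_closed product_piece.
Proof.
apply: closed_linear_image crossK _.
by apply: segre_product_closed; apply: cubic_closed.
Qed.

Lemma product_piece_isom :
  variety_isom product_piece (segre_product (cubic k) (cubic m)).
Proof.
apply: isom_linear_image crossK _.
by apply: segre_product_closed; apply: cubic_closed.
Qed.

Variables (r : 'rV[K]_k) (i0 : 'I_k).
Hypotheses (r1 : r 0 i0 = 1) (rC : cubic k <[r]>%VS).

Definition times_hom : 'Hom('rV[K]_m, 'rV[K]_(k * m)) :=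
  linfun (mxvec \o mulmx r^T).

(** The lines joining the fixed point [r] of the first cubic to the points of
    the second one.  When [#|A| = 2] the first cubic consists of three points,
    and the product splits into three such sets. *)
Definition fibre_piece :=
  [set (cross \o times_hom) @: l | l in cubic m]%VS.

Lemma fibre_homK : cancel (cross \o times_hom)%VF
  (row_hom K m i0 \o cross_inv K f g)%VF.
Proof.
move=> v; rewrite !comp_lfunE crossK !lfunE /= mxvecK.
by apply/rowP => j; rewrite !mxE big_ord1 mxE r1 mul1r.
Qed.

Lemma fibre_pieceP l : fibre_piece l <->
  exists p q, [/\ split_along A p q, p = p 0 (f i0) *: (r *m embed_mx K f)
                 & l = wedge_line p q].
Proof.
have fi : injective f by apply: elt_inj.
split.
  move=> [x Cx <-]; have [v v0 xE] := closed_point (cubic_closed m) Cx.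
  move: Cx; rewrite xE => cv; exists (r *m embed_mx K f), (v *m embed_mx K g).
  rewrite embed_in // r1 scale1r; split=> //; first exact: split_along_embed.
  by rewrite limg_line comp_lfunE [times_hom _]lfunE /= cross_hom_outer.
move=> [p [q [spl pr ->]]]; have [_ qE _ cv] := split_alongP spl.
set v := \row_i q 0 (g i) in qE cv; exists <[v]>%VS => //.
rewrite limg_line comp_lfunE [times_hom _]lfunE /= cross_hom_outer -qE pr.
rewrite wedge_lineZ //.
have [[p0 _ _ _ _] _] := spl.
by apply: contra_neq p0 => pi0; rewrite pr pi0 scale0r.
Qed.

Lemma fibre_piece_closed : zariski_closed fibre_piece.
Proof. exact: closed_linear_image fibre_homK (cubic_closed m). Qed.

Lemma fibre_piece_isom : variety_isom fibre_piece (cubic m).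
Proof. exact: isom_linear_image fibre_homK (cubic_closed m). Qed.

End Along.
End Pieces.

Arguments cubic K N : clear implicits.
Arguments product_piece K {n} k m A.
Arguments fibre_piece {K n k} m A r.

(** * Cube roots, supports and separation of the components *)

Section Pieces6.
Variable K : closedFieldType.
Hypotheses (c2 : 2%:R != 0 :> K) (c3 : 3%:R != 0 :> K).

(** They are [-1], [-w] and [-w^2] for a root [w] of [X^2 + X + 1], which is not
    [1] since [3 != 0]. *)
Lemma cube_roots_of_minus_one : exists r : 'I_3 -> K,
  injective r /\ forall x, x ^+ 3 = -1 <-> exists i, x = r i.
Proof.
have [w wE] : exists w : K, w ^+ 2 + w + 1 = 0.
  have [w wE] := @solve_monicpoly K 2 (fun=> -1) isT; exists w.
  by rewrite wE !big_ord_recl big_ord0 /bump /=; ring.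
have w1 : w != 1.
  apply: contra_neq c3 => w1; rewrite -wE w1; ring.
have w3 : w ^+ 3 = 1.
  by apply/eqP; rewrite -subr_eq0 -(mulr0 (w - 1)) -wE; apply/eqP; ring.
have w0 : w != 0.
  by apply: contra_eq_neq w3 => ->; rewrite expr0n eq_sym oner_eq0.
exists (fun i : 'I_3 => - w ^+ i); split=> [i j /oppr_inj|x].
  have ww1 : w ^+ 2 != 1.
    by apply: contra_neq w1 => ww1; rewrite -w3 exprS ww1 mulr1.
  have ww : w ^+ 2 != w.
    by apply: contra_neq w1 => ww; apply: (mulfI w0); rewrite mulr1 -expr2.
  move: i j => [[|[|[|//]]] ?] [[|[|[|//]]] ?] /eqP /=;
    rewrite ?expr0 ?expr1 => e; apply: val_inj => //=; exfalso;
    move: e; apply/negP => //; by rewrite eq_sym.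
split=> [x3|[i ->]].
  have : (x + 1) * ((x + w) * (x + w ^+ 2)) = 0.
    transitivity (x ^+ 3 + 1 + (w ^+ 2 + w + 1) * (x ^+ 2 + w * x)
      + (w ^+ 3 - 1)); first by ring.
    by rewrite x3 wE w3; ring.
  move=> /eqP; rewrite !mulf_eq0 !addr_eq0.
  move=> /or3P[]/eqP->;
    by [exists ord0|exists (lift ord0 ord0)|exists ord_max].
by rewrite exprNn -exprM mulnC exprM w3 expr1n; ring.
Qed.

Definition supp_set N (p : 'rV[K]_N) : {set 'I_N} :=
  finset (fun x => p 0 x != 0).

Lemma supp_set_gt1 N (p : 'rV[K]_N) :
  p != 0 -> polar p p p = 0 -> (1 < #|supp_set p|)%N.
Proof.
move=> /row_neq0[i pi] pp; rewrite ltnNge; apply/negP => /card_le1P supp.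
have only x : x != i -> p 0 x = 0.
  move=> xi; apply: contraNeq xi => px.
  by have := supp i; rewrite inE => /(_ pi x); rewrite !inE px => <-.
move: pp; rewrite /polar (bigD1 i) //= big1 => [/eqP|x /only->]; last first.
  by rewrite mulr0.
by rewrite addr0 !mulf_eq0 !(negPf pi).
Qed.

Definition full_along N (A : {set 'I_N}) (p q : 'rV[K]_N) : Prop :=
  forall x, if x \in A then p 0 x != 0 else q 0 x != 0.

Lemma embed_full n (A : {set 'I_n.+1}) k m (u : 'rV[K]_k) (v : 'rV[K]_m) :
    #|A| = k -> #|~: A| = m ->
    (forall i, u 0 i != 0) -> (forall i, v 0 i != 0) ->
  full_along A (u *m embed_mx K (@elt n A k))
    (v *m embed_mx K (@elt n (~: A) m)).
Proof.
move=> hA hA' un0 vn0 x; case: ifP => xA.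
  by have [i ->] := eltP hA xA; rewrite embed_in //; apply: elt_inj.
have xA' : x \in ~: A by rewrite inE xA.
by have [i ->] := eltP hA' xA'; rewrite embed_in //; apply: elt_inj.
Qed.

Lemma wedge_cross N (A : {set 'I_N}) (p q : 'rV[K]_N) x y :
  split_along A p q -> x \in A -> y \notin A -> wedge p q x y = p 0 x * q 0 y.
Proof.
move=> [_ supp] xA yA; rewrite wedgeE /det2.
by have := supp y; rewrite (negPf yA) => ->; rewrite mul0r subr0.
Qed.

Lemma wedge_line_eq N (p q p' q' : 'rV[K]_N) :
    wedge p q != 0 -> wedge_line p q = wedge_line p' q' ->
  exists2 c, c != 0 & wedge p q = c *: wedge p' q'.
Proof.
move=> w0 /line_eq[|c c0]; first by rewrite mxvec_eq0.
by rewrite -linearZ => /(can_inj mxvecK) ?; exists c.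
Qed.

Lemma split_wedge_neq0 N (A : {set 'I_N}) (p q : 'rV[K]_N) :
  split_along A p q -> wedge p q != 0.
Proof. by move=> [[p0 q0 pq _ _] _]; apply/wedge_neq0/disjoint_free. Qed.

Lemma split_along_nonempty N (A : {set 'I_N}) (p q : 'rV[K]_N) :
  split_along A p q -> exists x y, x \in A /\ y \notin A.
Proof.
move=> [[/row_neq0[x px] /row_neq0[y qy] _ _ _] supp]; exists x, y; split.
  by apply: contraNT px => xA; have := supp x; rewrite (negPf xA) => ->.
by apply: contraNN qy => yA; have := supp y; rewrite yA => ->.
Qed.

(** The nonzero entries of [wedge p q] are those whose row and column indices
    are separated by [A]; all of them must be separated by [A'], and [A] and
    [A'] have then the same partition into two blocks. *)
Lemma full_along_support N (A A' : {set 'I_N}) (p q p' q' : 'rV[K]_N) :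
    split_along A p q -> full_along A p q -> split_along A' p' q' ->
    wedge_line p q = wedge_line p' q' ->
  A' = A \/ A' = ~: A.
Proof.
move=> spl full spl' /(wedge_line_eq (split_wedge_neq0 spl))[c _ ww].
have sep x y : x \in A -> y \notin A -> (x \in A') != (y \in A').
  move=> xA yA; have : wedge p q x y != 0.
    rewrite (wedge_cross spl) // mulf_neq0 //.
      by have := full x; rewrite xA.
    by have := full y; rewrite (negPf yA).
  rewrite ww mxE wedgeE /det2; apply: contra_neq.
  have [_ supp] := spl'; have := supp x; have := supp y.
  case: (x \in A'); case: (y \in A') => // -> -> _;
    by rewrite !(mulr0, mul0r) subrr mulr0.
have [a [b [aA bA]]] := split_along_nonempty spl.
have [aA'|aA'] := boolP (a \in A'); [left|right]; apply/setP => x; rewrite ?inE.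
  have bA' : (b \in A') = false.
    by have := sep a b aA bA; rewrite aA'; case: (b \in A').
  have [xA|xA] := boolP (x \in A).
    by have := sep x b xA bA; rewrite bA'; case: (x \in A').
  by have := sep a x aA xA; rewrite aA'; case: (x \in A').
have bA' : b \in A'.
  by have := sep a b aA bA; rewrite (negPf aA'); case: (b \in A').
have [xA|xA] := boolP (x \in A).
  by have := sep x b xA bA; rewrite bA'; case: (x \in A').
by have := sep a x aA xA; rewrite (negPf aA'); case: (x \in A').
Qed.

(** * The fourfold: indexing the components *)

(** Complementation exchanges the [k]-subsets containing [x] with those
    avoiding it. *)
Lemma card_half_sets (T : finType) (x : T) k : #|T| = k.*2 ->
  (#|[pred A : {set T} | (#|A| == k) && (x \in A)]|.*2 = 'C(k.*2, k))%N.
Proof.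
move=> cT; pose P b := [pred A : {set T} | (#|A| == k)%N && ((x \in A) == b)].
have cardC (A : {set T}) : (#|~: A| == k) = (#|A| == k).
  rewrite -(eqn_add2l #|A|) (cardsC A) cT -addnn.
  by rewrite eqn_add2r eq_sym.
have PC : #|P true| = #|P false|.
  rewrite -(card_image (@finset.setC_inj T) (P false)); apply: eq_card => A.
  apply/idP/fintype.imageP => [|[B + ->]];
    rewrite !inE ?cardC ?eqb_id ?eqbF_neg //.
  by exists (~: A); rewrite ?finset.setCK // !inE cardC eqbF_neg negbK.
have PE : #|[pred A : {set T} | (#|A| == k)%N && (x \in A)]| = #|P true|.
  by apply: eq_card => A; rewrite !inE eqb_id.
have -> : 'C(k.*2, k) = (#|P true| + #|P false|)%N.
  rewrite -cT -card_draws cardsE -(cardID [pred A : {set T} | x \in A]).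
  by congr (_ + _)%N; apply: eq_card => A;
     rewrite !inE ?eqb_id ?eqbF_neg // andbC.
by rewrite PE -PC addnn.
Qed.

(** A partition into two triples is represented by the triple containing
    [ord0]; the second factor of a surface index chooses a cube root of [-1]. *)
Definition curve_index := {A : {set 'I_6} | (#|A| == 3)%N && (ord0 \in A)}.
Definition surface_index := ({A : {set 'I_6} | (#|A| == 2)%N} * 'I_3)%type.

Lemma card_curve_index : #|{: curve_index}| = 10%N.
Proof.
have := @card_half_sets 'I_6 ord0 3; rewrite card_ord => /(_ erefl).
by rewrite -[RHS]/(10.*2)%N card_sig => /double_inj.
Qed.

Lemma card_surface_index : #|{: surface_index}| = 45%N.
Proof.
rewrite card_prod card_sig card_ord.
have := card_draws 'I_6 2; rewrite card_ord cardsE => e.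
by rewrite (eq_card (B := [pred A : {set 'I_6} | (#|A| == 2)%N])) // e.
Qed.

Lemma card_compl6 (A : {set 'I_6}) a b :
  #|A| = a -> (a + b = 6)%N -> #|~: A| = b.
Proof.
move=> hA ab; apply/eqP; rewrite -(eqn_add2l #|A|) (cardsC A) card_ord hA.
by rewrite ab.
Qed.

(** If [ord0] is not in [A], exchanging the two points of the line replaces [A]
    by its complement. *)
Lemma line_in_product_piece (A : {set 'I_6}) (p q : 'rV[K]_6) :
    #|A| = 3%N -> split_along A p q ->
  exists t : curve_index, product_piece K 3 3 (val t) (wedge_line p q).
Proof.
move=> hA spl; have hA' := card_compl6 hA (erefl : (3 + 3 = 6)%N).
have [A0|A0] := boolP (ord0 \in A).
  have tP : (#|A| == 3)%N && (ord0 \in A) by rewrite hA A0.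
  by exists (Sub A tP); apply/product_pieceP => //; exists p, q.
have tP : (#|~: A| == 3)%N && (ord0 \in ~: A) by rewrite hA' inE A0.
exists (Sub (~: A) tP); apply/product_pieceP => //=.
  by rewrite finset.setCK.
exists q, p; split; last exact: wedge_lineC.
have [[p0 q0 pq pp qq] supp] := spl.
split; first by split=> // x; rewrite mulrC.
by move=> x; rewrite inE; have := supp x; case: (x \in A).
Qed.

Lemma split_along_supp N (p q : 'rV[K]_N) :
  split_pair p q -> split_along (supp_set p) p q.
Proof.
move=> spq; split=> // x; have [_ _ pq _ _] := spq; rewrite inE.
by have /eqP := pq x; rewrite mulf_eq0; case: eqVneq => //= _ /eqP.
Qed.

Lemma polar_rV2 (u : 'rV[K]_2) :
  polar u u u = u 0 ord0 ^+ 3 + u 0 ord_max ^+ 3.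
Proof.
rewrite /polar !big_ord_recl big_ord0 addr0.
rewrite (_ : lift ord0 ord0 = ord_max); last exact: val_inj.
by rewrite !exprS expr0 !mulr1 !mulrA.
Qed.

Section Roots.
Variable r : 'I_3 -> K.
Hypothesis rinj : injective r.
Hypothesis rP : forall x, x ^+ 3 = -1 <-> exists i, x = r i.

(** For [c^3 = -1], a point of the binary cubic [x^3 + y^3 = 0]. *)
Definition binary_point (c : K) : 'rV[K]_2 := \row_i c ^+ i.

Lemma binary_point_cubic i : cubic K 2 <[binary_point (r i)]>%VS.
Proof.
apply/fermat_hypersurface; split.
  by apply/eqP => /rowP/(_ ord0); rewrite !mxE expr0 => /eqP; rewrite oner_eq0.
have r3 : r i ^+ 3 = -1 by apply/rP; exists i.
by rewrite polar_rV2 !mxE /= expr0 expr1 expr1n r3 subrr.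
Qed.

Definition surface_piece (t : surface_index) :=
  fibre_piece 4 (val t.1) (binary_point (r t.2)).

Lemma line_in_surface_piece (p q : 'rV[K]_6) :
    split_pair p q -> #|supp_set p| = 2%N ->
  exists t, surface_piece t (wedge_line p q).
Proof.
move=> spq hA; have spl := split_along_supp spq; set A := supp_set p in hA spl.
have hA' := card_compl6 hA (erefl : (2 + 4 = 6)%N).
have [+ _ /fermat_hypersurface[_ +] _] := split_alongP hA hA' spl.
set u := \row_i _ => pE uu; set a := u 0 ord0; set b := u 0 ord_max.
have a0 : a != 0.
  by have := elt_in (ord0 : 'I_2) hA; rewrite inE /a mxE.
have ab : a ^+ 3 + b ^+ 3 = 0.
  by rewrite -uu polar_rV2.
have /rP[i bi] : (b / a) ^+ 3 = -1.
  rewrite expr_div_n -(addrK (a ^+ 3) (b ^+ 3)) [b ^+ 3 + _]addrC ab sub0r.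
  by rewrite mulNr divff ?expf_neq0.
have tP : (#|A| == 2)%N by rewrite hA.
exists (Sub A tP, i); apply/(@fibre_pieceP _ _ _ _ _ hA hA' _ ord0).
- by rewrite mxE expr0.
- exact: binary_point_cubic.
exists p, q; split=> //=.
have -> : p 0 (elt A (ord0 : 'I_2)) = a by rewrite /a mxE.
rewrite {1}pE scalemxAl; congr (_ *m _); apply/rowP => k.
rewrite [RHS]mxE [binary_point _ 0 k]mxE -bi.
have [->|->] : k = ord0 \/ k = ord_max.
- by case: k => [[|[|//]] ?]; [left|right]; apply: val_inj.
- by rewrite expr0 mulr1.
- by rewrite expr1 mulrC divfK.
Qed.

Definition piece (t : curve_index + surface_index) :=
  match t with
  | inl A => product_piece K 3 3 (val A)
  | inr t => surface_piece t
  end.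

Definition index_set (t : curve_index + surface_index) : {set 'I_6} :=
  match t with inl A => val A | inr t => val t.1 end.

Lemma card_index_curve (A : curve_index) :
  #|val A| = 3%N /\ #|~: val A| = 3%N.
Proof.
by have /andP[/eqP hA _] := valP A; split=> //; apply: card_compl6 hA _.
Qed.

Lemma card_index_surface (A : {A : {set 'I_6} | (#|A| == 2)%N}) :
  #|val A| = 2%N /\ #|~: val A| = 4%N.
Proof. by have /eqP hA := valP A; split=> //; apply: card_compl6 hA _. Qed.

Lemma surface_pieceP t l : surface_piece t l <->
  exists p q, [/\ split_along (val t.1) p q,
    p = p 0 (elt (val t.1) (ord0 : 'I_2)) *:
          (binary_point (r t.2) *m embed_mx K (@elt _ (val t.1) 2))
    & l = wedge_line p q].
Proof.
have [hA hA'] := card_index_surface t.1.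
apply: fibre_pieceP => //; last exact: binary_point_cubic.
by rewrite mxE expr0.
Qed.

Lemma piece_split t l : piece t l ->
  exists p q, split_along (index_set t) p q /\ l = wedge_line p q.
Proof.
case: t => [A|t] /=.
  by have [hA hA'] := card_index_curve A; move/(product_pieceP hA hA').
by move=> /surface_pieceP[p [q [spl _ ->]]]; exists p, q.
Qed.

(** Both points of a split pair have at least two nonzero coordinates.  If one
    has exactly two, the line is in a surface component; otherwise the six
    coordinates are shared three and three. *)
Lemma F2_pieces : F2_locus (n := 4) (fermat_cubic K 6) = \bigcup_t piece t.
Proof.
apply/seteqP; split=> l.
  move=> /(@F2_fermatP K 4 l c2 c3 isT)[p [q [spq ->]]].
  have spq' : split_pair q p.
    by have [p0 q0 pq pp qq] := spq; split=> // x; rewrite mulrC.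
  have [p0 q0 pq pp qq] := spq.
  have p2 := supp_set_gt1 p0 pp; have q2 := supp_set_gt1 q0 qq.
  have [hp|hp] := eqVneq #|supp_set p| 2%N.
    by have [t ht] := line_in_surface_piece spq hp; exists (inr t).
  have [hq|hq] := eqVneq #|supp_set q| 2%N.
    have [t ht] := line_in_surface_piece spq' hq; exists (inr t) => //=.
    by rewrite wedge_lineC.
  have qp : supp_set q \subset ~: supp_set p.
    apply/fintype.subsetP => x; rewrite !inE => qx; rewrite negbK.
    by have /eqP := pq x; rewrite mulf_eq0 (negPf qx) orbF.
  have := subset_leq_card qp; have := cardsC (supp_set p).
  rewrite card_ord => cp cq.
  have h3 : #|supp_set p| = 3%N by lia.
  have [t ht] := line_in_product_piece h3 (split_along_supp spq).
  by exists (inl t).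
move=> [t _ /piece_split[p [q [[spq _] ->]]]].
by apply/(@F2_fermatP K 4 _ c2 c3 isT); exists p, q.
Qed.

Lemma full_cubic3 : exists u : 'rV[K]_3,
  cubic K 3 <[u]>%VS /\ forall i, u 0 i != 0.
Proof.
have [x xE] :=
  @solve_monicpoly K 3 (fun i => if i is 0%N then - 2%:R else 0) isT.
have x3 : x ^+ 3 = - 2%:R.
  by rewrite xE !big_ord_recl big_ord0 /= !mul0r expr0 mulr1 !addr0.
have x0 : x != 0.
  by apply: contra_eq_neq x3 => ->; rewrite expr0n /= eq_sym oppr_eq0.
pose u : 'rV[K]_3 := \row_i (if i == ord_max then x else 1).
have un0 i : u 0 i != 0 by rewrite mxE; case: ifP => _ //; apply: oner_neq0.
exists u; split=> //; apply/fermat_hypersurface; split.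
  by apply: contraNneq (un0 ord0) => ->; rewrite mxE.
rewrite /polar !big_ord_recl big_ord0 !mxE /=.
by transitivity (2%:R + x ^+ 3); [ring|rewrite x3 subrr].
Qed.

Lemma full_cubic4 : exists u : 'rV[K]_4,
  cubic K 4 <[u]>%VS /\ forall i, u 0 i != 0.
Proof.
pose u : 'rV[K]_4 := \row_i (-1) ^+ i.
have un0 i : u 0 i != 0 by rewrite mxE signr_eq0.
exists u; split=> //; apply/fermat_hypersurface; split.
  by apply: contraNneq (un0 ord0) => ->; rewrite mxE.
by rewrite /polar !big_ord_recl big_ord0 !mxE /= /bump /=; ring.
Qed.

Lemma full_point t : exists p q,
  [/\ split_along (index_set t) p q, full_along (index_set t) p q
    & piece t (wedge_line p q)].
Proof.
case: t => [A|[A i]] /=.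
  have [hA hA'] := card_index_curve A; have [u [cu un0]] := full_cubic3.
  have spl := split_along_embed hA hA' cu cu.
  exists (u *m embed_mx K (@elt _ (val A) 3)).
  exists (u *m embed_mx K (@elt _ (~: val A) 3)).
  split=> //; first exact: embed_full.
  by apply/product_pieceP => //; do 2!eexists; split; first exact: spl.
have [hA hA'] := card_index_surface A; have [v [cv vn0]] := full_cubic4.
have spl := split_along_embed hA hA' (binary_point_cubic i) cv.
have r0 : r i != 0.
  have : r i ^+ 3 = -1 by apply/rP; exists i.
  by apply: contra_eq_neq => ->; rewrite expr0n /= eq_sym oppr_eq0 oner_eq0.
do 2!eexists; split; first exact: spl.
  by apply: embed_full => // j; rewrite mxE expf_neq0.
apply/surface_pieceP; do 2!eexists; split; first exact: spl; last by [].
by rewrite embed_in ?mxE ?expr0 ?scale1r //; apply: elt_inj.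
Qed.

(** A point of full support determines the index set up to complement, and the
    normalisation by cardinality and [ord0] removes that ambiguity.  For surface
    components the cube root is the ratio of the two coordinates of [p], which
    can be read off two rows of [wedge p q]. *)
Lemma piece_inj : injective piece.
Proof.
move=> t t' tt'; have [p [q [spl full pt]]] := full_point t.
have : piece t' (wedge_line p q) by rewrite -tt'.
case: t t' spl full {tt'} pt => [A|[A i]] [A'|[A' i']] /= spl full.
- move=> _ h; have [p' [q' [spl' ww]]] := @piece_split (inl A') _ h.
  have [e|e] : val A' = val A \/ val A' = ~: val A :=
    full_along_support spl full spl' ww.
    by congr inl; apply: val_inj.
  have /andP[_ A0] := valP A; have /andP[_] := valP A'.
  by rewrite e inE A0.
- move=> _ h; have [p' [q' [spl' ww]]] := @piece_split (inr (A', i')) _ h.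
  have [c3A c3A'] := card_index_curve A; have [c2A' _] := card_index_surface A'.
  have [e|e] : val A' = val A \/ val A' = ~: val A :=
      full_along_support spl full spl' ww;
    by move: c2A'; rewrite e ?c3A ?c3A'.
- move=> _ h; have [p' [q' [spl' ww]]] := @piece_split (inl A') _ h.
  have [c2A c4A] := card_index_surface A; have [c3A' _] := card_index_curve A'.
  have [e|e] : val A' = val A \/ val A' = ~: val A :=
      full_along_support spl full spl' ww;
    by move: c3A'; rewrite e ?c2A ?c4A.
move=> /surface_pieceP[p1 [q1 [/= spl1 p1E ww1]]].
move=> /surface_pieceP[p2 [q2 [/= spl2 p2E ww2]]].
have [hA hA'] := card_index_surface A; have [hB hB'] := card_index_surface A'.
have AA' : A' = A.
  apply: val_inj; have [//|e] : val A' = val A \/ val A' = ~: val A :=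
    full_along_support spl full spl2 ww2.
  by move: hB; rewrite e hA'.
rewrite {}AA' in spl2 p2E hB hB' *; congr (inr (_, _)).
have ratio p' q' j : split_along (val A) p' q' ->
    p' = p' 0 (elt (val A) (ord0 : 'I_2)) *:
           (binary_point (r j) *m embed_mx K (@elt _ (val A) 2)) ->
    wedge_line p q = wedge_line p' q' -> p 0 (elt (val A) (ord_max : 'I_2)) =
    r j * p 0 (elt (val A) (ord0 : 'I_2)).
  move=> spl' pE /(wedge_line_eq (split_wedge_neq0 spl))[c c0 ww].
  have [_ [y [_ yA]]] := split_along_nonempty spl.
  have qy : q 0 y != 0 by have := full y; rewrite (negPf yA).
  have WE k : p 0 (elt (val A) (k : 'I_2)) * q 0 y =
              c * (p' 0 (elt (val A) k) * q' 0 y).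
    by rewrite -!(wedge_cross (A := val A)) ?elt_in // ww mxE.
  have := congr1 (fun m : 'rV[K]_6 => m 0 (elt (val A) (ord_max : 'I_2))) pE.
  rewrite [RHS]mxE embed_in; last exact: elt_inj.
  rewrite mxE expr1 => p'E; apply: (mulIf qy).
  by rewrite -[RHS]mulrA !WE p'E; ring.
have := ratio _ _ _ spl1 p1E ww1; rewrite (ratio _ _ _ spl2 p2E ww2).
move=> /mulIf e; apply/esym/rinj/e.
by have := full (elt (val A) (ord0 : 'I_2)); rewrite elt_in.
Qed.

End Roots.
End Pieces6.

Lemma ord_bijection (T : finType) n :
  #|T| = n -> exists e : 'I_n -> T, bijective e.
Proof.
move=> <-; exists enum_val; exists enum_rank.
  exact: enum_valK.
exact: enum_rankK.
Qed.

Theorem fermat_F2_decomposition (K : closedFieldType) :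
    2%:R != 0 :> K -> 3%:R != 0 :> K ->
  exists Z : 'I_10 + 'I_45 -> set {vspace 'rV[K]_(6 * 6)},
    [/\ F2_locus (n := 4) (fermat_cubic K 6) = \bigcup_k Z k,
        injective Z,
        forall k, zariski_closed (Z k),
        forall i : 'I_10, variety_isom (Z (inl i))
          (segre_product (cubic K 3) (cubic K 3))
      & forall j : 'I_45, variety_isom (Z (inr j)) (cubic K 4)].
Proof.
move=> c2 c3.
have [r [rinj rP]] := cube_roots_of_minus_one c3.
have [e1 e1_bij] := ord_bijection card_curve_index.
have [e2 e2_bij] := ord_bijection card_surface_index.
pose index (k : 'I_10 + 'I_45) :=
  match k with inl i => inl (e1 i) | inr j => inr (e2 j) end.
have index_inj : injective index.
  move=> [i|j] [i'|j'] //= [] => [/(bij_inj e1_bij)->|/(bij_inj e2_bij)->];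
    by [].
exists (fun k => piece r (index k)); split.
- rewrite (F2_pieces c2 c3 rP); apply/seteqP; split=> l [t _ lt]; last first.
    by exists (index t).
  have [[f1 _ e1K] [f2 _ e2K]] := (e1_bij, e2_bij).
  case: t lt => t lt.
    by exists (inl (f1 t)); [|rewrite /index e1K].
  by exists (inr (f2 t)); [|rewrite /index e2K].
- by move=> k k' /(piece_inj c2 rinj rP)/index_inj.
- case=> [i|j] /=.
    by have [hA hA'] := card_index_curve (e1 i); apply: product_piece_closed.
  have [hA hA'] := card_index_surface (e2 j).1.
  by apply: (fibre_piece_closed hA hA' (i0 := ord0)); rewrite mxE expr0.
- move=> i; have [hA hA'] := card_index_curve (e1 i).
  exact: product_piece_isom.
- move=> j; have [hA hA'] := card_index_surface (e2 j).1.
  by apply: (fibre_piece_isom hA hA' (i0 := ord0)); rewrite mxE expr0.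
Qed.

Theorem theoremA (R : realType) :
  let C := hypersurface (fermat_cubic R[i] 3) in
  let S := hypersurface (fermat_cubic R[i] 4) in
  exists Z : 'I_10 + 'I_45 -> set {vspace 'rV[R[i]]_(6 * 6)},
    [/\ F2_locus (n := 4) (fermat_cubic R[i] 6) = \bigcup_k Z k,
        injective Z,
        forall k, zariski_closed (Z k),
        forall i : 'I_10, variety_isom (Z (inl i)) (segre_product C C)
      & forall j : 'I_45, variety_isom (Z (inr j)) S].
Proof.
by apply: fermat_F2_decomposition; rewrite Num.Theory.pnatr_eq0.
Qed.
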